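(* Let $\Omega\subset\mathbb{R}^2$ be a bounded, connected, open set with Lipschitz boundary, let $T:L^2(\Omega)\to L^2(\Omega)$ be a bounded linear operator, $u_0\in L^2(\Omega)$, $\alpha>0$ and $\beta>0$. Let $f:\mathbb{R}^2\to\mathbb{R}^+$ and $g:\mathbb{R}^4\to\mathbb{R}^+$ be convex functions, both minimised at $0$, for which there are constants $K_1,K_2,K_3,K_4>0$ with $K_3|x|\le f(x)\le K_1(1+|x|)$ for all $x\in\mathbb{R}^2$ and $K_4|x|\le g(x)\le K_2(1+|x|)$ for all $x\in\mathbb{R}^4$. Define, for $u\in BH(\Omega)$, $$\overline{H_{ex}}(u)=\frac12\int_\Omega (u_0-Tu)^2\,dx+\alpha\int_\Omega f(\nabla u)\,dx+\beta\, g(D^2u)(\Omega).$$ If $T(\mathcal{X}_\Omega)\neq0$ (with $\mathcal{X}_\Omega$ the characteristic function of $\Omega$) and, in addition, $T$ is injective or $f$ is strictly convex, then the solution of the minimisation problem $\inf_{u\in BH(\Omega)}\overline{H_{ex}}(u)$ is unique.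
   Context: $BH(\Omega)=\{u\in W^{1,1}(\Omega):\nabla u\in[BV(\Omega)]^2\}$ is the space of functions of bounded Hessian. For $u\in BH(\Omega)$, $D^2u:=D(\nabla u)$ is the distributional derivative of $\nabla u$, a $2\times2$-matrix-valued (identified with $\mathbb{R}^4$-valued) finite Radon measure. $\nabla^2u$ is the density of $D^2u$ with respect to Lebesgue measure $\mathcal{L}^2$ and $D^s\nabla u$ is its singular part. Convex functions of measures: for convex $g:\mathbb{R}^4\to\mathbb{R}$ with at most linear growth, the recession function is $g_\infty(x)=\lim_{t\to\infty}g(tx)/t$, and $$g(D^2u)(\Omega)=\int_\Omega g(\nabla^2u)\,dx+\int_\Omega g_\infty\!\left(\frac{D^s\nabla u}{|D^s\nabla u|}\right)d|D^s\nabla u|,$$ where $|\cdot|$ of a measure is its total variation measure and $\frac{D^s\nabla u}{|D^s\nabla u|}$ is the Radon-Nikodym density (polar decomposition). *)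

(* Defs.v *)
From HB Require Import structures.
From mathcomp Require Import all_boot all_order all_algebra.
From mathcomp Require Import all_classical all_reals all_analysis.
From mathcomp Require Import ring lra.
Set Implicit Arguments.
Unset Strict Implicit.
Unset Printing Implicit Defensive.
Import Order.TTheory GRing.Theory Num.Theory.
Import numFieldNormedType.Exports.
Local Open Scope classical_set_scope.
Local Open Scope ring_scope.

(* R * R with its Borel sigma-algebra (measurableTypeR R unfolds to R) *)
Notation plane R := (measurableTypeR R * measurableTypeR R)%type.

Section lebesgue_plane.
Context {R : realType}.

Definition leb2 : set (plane R) -> \bar R :=
  (@lebesgue_measure R \x @lebesgue_measure R)%E.

HB.instance Definition _ := Measure.on leb2.

Let leb2_sigma_finite : sigma_finite [set: plane R] leb2.
Proof.
have /sigma_finiteP[F [TF ndF Foo]] := sigma_finiteT (@lebesgue_measure R).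
exists (fun n => F n `*` F n).
  rewrite -setXTT TF predeqE => -[x y]; split.
    move=> [/= [n _ Fnx] [k _ Fky]]; exists (maxn n k) => //; split.
    - by move: x Fnx; exact/subsetPset/ndF/leq_maxl.
    - by move: y Fky; exact/subsetPset/ndF/leq_maxr.
  by move=> [n _ []/= ? ?]; split; exists n.
move=> k; have [? ?] := Foo k.
split; first exact: measurableX.
by rewrite /leb2 product_measure1E// lte_mul_pinfty// ge0_fin_numE.
Qed.

HB.instance Definition _ :=
  Measure_isSigmaFinite.Build _ _ _ leb2 leb2_sigma_finite.

Lemma open_measurable_plane (A : set (R * R)) :
  open A -> measurable (A : set (plane R)).
Proof.
move=> oA.
pose box (q : (rat * rat * rat)%type) : set (plane R) :=
  (ball (ratr q.1.1 : R) (ratr q.2)) `*` (ball (ratr q.1.2 : R) (ratr q.2)).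
have -> : A = \bigcup_(q in [set q | box q `<=` A]) box q.
  apply/seteqP; split => [[x y] Axy|z [q /= + qz]]; last exact.
  have [e /= e0 eA] : exists2 e : R, 0 < e & ball (x, y) e `<=` A.
    by have /nbhs_ballP[e e0 eA] := open_nbhs_nbhs (conj oA Axy); exists e.
  have [r /andP[r0 re]] : exists r : rat, 0 < (ratr r : R) < e / 2.
    have [r] := rat_in_itvoo (divr_gt0 e0 (@ltr0Sn R 1)).
    by rewrite in_itv/=; exists r.
  have rat_near (t : R) : exists q : rat, `|ratr q - t| < ratr r.
    have [|q] := @rat_in_itvoo R (t - ratr r) (t + ratr r).
      by rewrite ltrD2l gt0_cp.
    rewrite in_itv/= => /andP[q1 q2]; exists q.
    by rewrite ltr_norml; apply/andP; split; lra.
  have [q1 q1x] := rat_near x; have [q2 q2y] := rat_near y.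
  exists (q1, q2, r) => /=; last by split.
  move=> [s t] [/= qs qt]; apply: eA; split.
    move: qs q1x; rewrite /ball/= !ltr_norml => /andP[? ?] /andP[? ?].
    by apply/andP; split; lra.
  move: qt q2y; rewrite /ball/= !ltr_norml => /andP[? ?] /andP[? ?].
  by apply/andP; split; lra.
rewrite bigcup_mkcond; apply: countable_bigcupT_measurable => // q.
case: ifP => // _; apply: measurableX; apply: measurable_realfun.open_measurable; exact: ball_open.
Qed.

End lebesgue_plane.

Section euclidean_norm.
Context {R : realType} {I : finType}.
Implicit Types x y : I -> R.

Definition enorm x : R := Num.sqrt (\sum_i x i ^+ 2).

Lemma enorm_ge0 x : 0 <= enorm x.
Proof. exact: sqrtr_ge0. Qed.

Lemma sqr_enorm x : enorm x ^+ 2 = \sum_i x i ^+ 2.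
Proof. by rewrite sqr_sqrtr// sumr_ge0// => i _; exact: sqr_ge0. Qed.

Lemma enorm0 x : (forall i, x i = 0) -> enorm x = 0.
Proof.
by move=> x0; rewrite /enorm big1 ?sqrtr0// => i _; rewrite x0 expr0n.
Qed.

Lemma enorm_dual x : exists c : I -> R,
  [/\ forall i, `|c i| <= 1, forall y, \sum_i c i * y i <= enorm y
    & \sum_i c i * x i = enorm x].
Proof.
have [x0|x0] := eqVneq (enorm x) 0.
  exists (fun=> 0); split => [i|y|].
  - by rewrite normr0.
  - by rewrite big1 ?enorm_ge0// => i _; rewrite mul0r.
  - by rewrite big1 ?x0// => i _; rewrite mul0r.
pose c i := x i / enorm x.
have c1 : \sum_i c i ^+ 2 = 1.
  under eq_bigr do rewrite expr_div_n.
  by rewrite -mulr_suml -sqr_enorm divff// expf_neq0.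
exists c; split => [i|y|].
- rewrite -(@ler_pXn2r _ 2)// ?nnegrE// expr1n real_normK ?num_real//.
  by rewrite -c1 (bigD1 i)//= lerDl sumr_ge0// => j _; exact: sqr_ge0.
- set t := \sum_i _.
  have : 0 <= \sum_i (t * c i - y i) ^+ 2.
    by apply: sumr_ge0 => i _; exact: sqr_ge0.
  have -> : \sum_i (t * c i - y i) ^+ 2 = enorm y ^+ 2 - t ^+ 2.
    rewrite (eq_bigr (fun i => t ^+ 2 * c i ^+ 2 - t *+ 2 * (c i * y i)
      + y i ^+ 2)); last by move=> i _; ring.
    rewrite big_split/= sumrB -!mulr_sumr c1 -/t sqr_enorm; ring.
  rewrite subr_ge0 => ty; have [t0|t0] := leP t 0.
    by rewrite (le_trans t0)// enorm_ge0.
  by rewrite -(@ler_pXn2r _ 2)// ?nnegrE ?enorm_ge0// ltW.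
- under eq_bigr do rewrite mulrAC -expr2.
  by rewrite -mulr_suml -sqr_enorm expr2 mulfK.
Qed.

End euclidean_norm.

Section total_variation.
Local Open Scope ereal_scope.
Context d (T : measurableType d) (R : realType) (I : finType).
Variable mu : I -> {charge set T -> \bar R}.

Definition vnorm (A : set T) : \bar R := (enorm (fun i => fine (mu i A)))%:E.

Definition partitions (E : set T) : set (set T)^nat :=
  [set F | [/\ forall k, measurable (F k), trivIset setT F & \bigcup_k F k = E]].

(* measures are defined on all sets, hence the value on nonmeasurable sets *)
Definition tv (E : set T) : \bar R :=
  if E \in measurable
  then ereal_sup [set \sum_(k <oo) vnorm (F k) | F in partitions E] else 0.

Let vnorm_ge0 A : 0 <= vnorm A.
Proof. by rewrite lee_fin enorm_ge0. Qed.

Let vnorm0 : vnorm set0 = 0.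
Proof. by rewrite /vnorm enorm0// => i; rewrite charge0. Qed.

Let vnorm_sub (F : (set T)^nat) E : partitions E F ->
  vnorm E <= \sum_(k <oo) vnorm (F k).
Proof.
move=> [mF tF <-]; set E' := \bigcup_k F k.
have mE : measurable E' by exact: bigcup_measurable.
have [c [_ cy cE]] := enorm_dual (fun i => fine (mu i E')).
have cvg_i i : (fun n => \sum_(0 <= k < n) fine (mu i (F k)))%R @ \oo -->
    fine (mu i E').
  have := @charge_semi_sigma_additive _ _ _ (mu i) _ mF tF mE.
  rewrite -[X in _ --> X](@fineK _ (mu i E')) ?fin_num_measure//.
  move/fine_cvg; apply: cvg_trans; apply: near_eq_cvg; near=> n => /=.
  by rewrite -sum_fine// => k _; exact: fin_num_measure.
pose u n := (\sum_i c i * \sum_(0 <= k < n) fine (mu i (F k)))%R.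
have cvg_u : u @ \oo --> (\sum_i c i * fine (mu i E'))%R.
  rewrite /u; elim: (index_enum I) => [|i s ih].
    by under eq_fun do rewrite big_nil; rewrite big_nil; exact: cvg_cst.
  under eq_fun do rewrite big_cons; rewrite big_cons.
  by apply: cvgD => //; apply: cvgMl_tmp; exact: cvg_i.
rewrite /vnorm -cE.
have cvg_eu : (EFin \o u) @ \oo --> (\sum_i c i * fine (mu i E'))%:E.
  apply: cvg_EFin; first exact: nearW.
    exact: cvg_u.
rewrite -(cvg_lim _ cvg_eu)//; apply: lime_le.
  by apply/cvg_ex; eexists; exact: cvg_eu.
apply: nearW => n /=.
apply: (@le_trans _ _ (\sum_(0 <= k < n) vnorm (F k))); last first.
  by apply: nneseries_lim_ge => k _ _; exact: vnorm_ge0.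
rewrite sumEFin lee_fin /u.
under eq_bigr do rewrite mulr_sumr.
by rewrite exchange_big/=; apply: ler_sum => k _; exact: cy.
Unshelve. all: end_near. Qed.

Let partition1 E : measurable E -> partitions E (bigcup2 E set0).
Proof.
move=> mE; split.
- by move=> [|[|k]] /=.
- by rewrite -trivIset_bigcup2 setI0.
- by rewrite bigcup2E setU0.
Qed.

Lemma vnorm_le_tv E : measurable E -> vnorm E <= tv E.
Proof.
move=> mE; rewrite /tv mem_set//.
apply: (@le_trans _ _ (\sum_(k <oo) vnorm (bigcup2 E set0 k))).
  exact/vnorm_sub/partition1.
by apply: ereal_sup_ubound; exists (bigcup2 E set0) => //; exact: partition1.
Qed.

Let tv_ge0 E : 0 <= tv E.
Proof.
have [mE|mE] := boolP (E \in measurable); last by rewrite /tv (negbTE mE).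
by rewrite (le_trans (vnorm_ge0 E))// vnorm_le_tv// -inE.
Qed.

Let tv_lty E : measurable E -> tv E < +oo.
Proof.
move=> mE; have /choice[V HV] : forall i, exists V : {measure set T -> \bar R},
    (forall A, measurable A -> V A < +oo) /\
    forall A, measurable A -> `|mu i A| <= V A.
  move=> i; have [P [N PN]] := Hahn_decomposition (mu i).
  exists (charge_variation PN); split => A mA; last exact: abse_charge_variation.
  by rewrite ltey_eq fin_num_measure.
have vnormV A : measurable A -> vnorm A <= \sum_i V i A.
  move=> mA; have [c [c1 _ cE]] := enorm_dual (fun i => fine (mu i A)).
  rewrite /vnorm -cE -sumEFin; apply: lee_sum => i _.
  apply: le_trans ((HV i).2 _ mA).
  rewrite -[X in `|X|](@fineK _ (mu i A)) ?fin_num_measure// abse_EFin lee_fin.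
  by rewrite (le_trans (ler_norm _))// normrM ler_piMl.
apply: (@le_lt_trans _ _ (\sum_i V i E)); last first.
  by apply: lte_sum_pinfty => i _; exact: (HV i).1.
rewrite /tv mem_set//; apply: ge_ereal_sup => _ /= [F [mF tF FE] <-].
apply: (@le_trans _ _ (\sum_(k <oo) \sum_i V i (F k))).
  by apply: lee_nneseries => // k _; exact: vnormV.
rewrite nneseries_sum//; apply: lee_sum => i _.
rewrite -FE (measure_semi_bigcup (V i))//; first by rewrite FE.
Qed.

Let tv0 : tv set0 = 0.
Proof.
apply/eqP; rewrite eq_le tv_ge0 andbT /tv mem_set//.
apply: ge_ereal_sup => _ /= [F [mF tF F0] <-].
rewrite eseries0// => k _ _; suff -> : F k = set0 by [].
by apply/seteqP; split=> // x Fkx; rewrite -F0; exists k.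
Qed.

Let tv_sigma_additive : semi_sigma_additive tv.
Proof.
move=> A mA tA mUA; set E := \bigcup_n A n.
suff -> : tv E = \sum_(n <oo) tv (A n) by exact: is_cvg_nneseries.
apply/eqP; rewrite eq_le; apply/andP; split.
  rewrite {1}/tv mem_set//; apply: ge_ereal_sup => _ /= [F [mF tF FE] <-].
  have mFA i k : measurable (F k `&` A i) by exact: measurableI.
  apply: (@le_trans _ _ (\sum_(k <oo) \sum_(i <oo) vnorm (F k `&` A i))).
    apply: lee_nneseries => // k _; apply: vnorm_sub; split => //.
      by apply: trivIset_setIl.
    rewrite -setI_bigcupr; apply/setIidPl; rewrite -/E -FE.
    exact: bigcup_sup.
  rewrite nneseries_interchange//; apply: lee_nneseries => [i _ _|i _].
    by apply: nneseries_ge0 => k _ _; exact: vnorm_ge0.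
  rewrite /tv mem_set//; apply: ereal_sup_ubound.
  exists (fun k => F k `&` A i) => //; split => //.
    by apply: trivIset_setIr.
  rewrite -setI_bigcupl; apply/setIidPr; rewrite FE.
  exact: bigcup_sup.
apply/lee_addgt0Pr => e e0.
have /choice[G HG] : forall i, exists G, partitions (A i) G /\
    tv (A i) <= \sum_(k <oo) vnorm (G k) + (e / (2 ^ i.+1)%:R)%:E.
  move=> i; pose ei := (e / (2 ^ i.+1)%:R)%R.
  have ei0 : (0 < ei)%R by rewrite divr_gt0// ltr0n expn_gt0.
  have Afin : tv (A i) \is a fin_num by rewrite ge0_fin_numE// tv_lty.
  have := Afin; rewrite /tv mem_set// => Sfin.
  have [_ [G PG <-] GS] := ub_ereal_sup_adherent ei0 Sfin.
  by exists G; split => //; rewrite -leeBlDr// ltW.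
apply: (@le_trans _ _ (\sum_(i <oo)
    (\sum_(k <oo) vnorm (G i k) + (e / (2 ^ i.+1)%:R)%:E))).
  by apply: lee_nneseries => // i _; exact: (HG i).2.
apply: le_trans (epsilon_trick _ _ _) _.
- by move=> i; exact: nneseries_ge0.
- exact: ltW.
rewrite leeD2r//.
have /ppcard_eqP[h] : ([set: nat] #= [set: nat * nat])%card.
  by rewrite card_eq_sym; exact: card_nat2.
pose H n := G (h n).1 (h n).2.
have -> : \sum_(i <oo) \sum_(k <oo) vnorm (G i k) = \sum_(n <oo) vnorm (H n).
  rewrite !nneseries_esumT//; last by move=> i; exact: nneseries_ge0.
  under eq_esum do rewrite nneseries_esumT//.
  rewrite esum_esum// [X in \esum_(_ in X) _](_ : _ = [set: nat * nat]); last first.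
    by apply/seteqP; split.
  rewrite (reindex_esum [set: nat] _ h)//.
rewrite /tv mem_set//; apply: ereal_sup_ubound; exists H => //; split.
- by move=> n; have [[+ _ _] _] := HG (h n).1; exact.
- apply/trivIsetP => m n _ _ mn; rewrite /H.
  have hmn : h m != h n.
    by apply: contra mn => /eqP/(@inj _ _ _ h)-> //; rewrite inE.
  have [e1|ne1] := eqVneq (h m).1 (h n).1.
    have [[_ /trivIsetP tG _] _] := HG (h n).1.
    rewrite e1; apply: tG => //; apply: contra hmn => /eqP e2.
    by rewrite [h m]surjective_pairing [h n]surjective_pairing e1 e2.
  have [[_ _ Am] _] := HG (h m).1; have [[_ _ An] _] := HG (h n).1.
  apply/seteqP; split => // x [Gm Gn].
  have : (A (h m).1 `&` A (h n).1) x.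
    by split; [rewrite -Am; exists (h m).2|rewrite -An; exists (h n).2].
  by move/trivIsetP : tA => ->.
- apply/seteqP; split => [x [n _ Hx]|x [i _ Ax]].
    by have [[_ _ An] _] := HG (h n).1; exists (h n).1 => //; rewrite -An; exists (h n).2.
  have [[_ _ Ai] _] := HG i; move: Ax; rewrite -Ai => -[k _ Gx].
  have [n _ hn] := @surj _ _ _ _ h (i, k) Logic.I.
  by exists n => //; rewrite /H hn.
Qed.

HB.instance Definition _ :=
  isMeasure.Build _ _ _ tv tv0 tv_ge0 tv_sigma_additive.

Let tv_fin : fin_num_fun tv.
Proof. by move=> E mE; rewrite ge0_fin_numE// tv_lty. Qed.

HB.instance Definition _ := Measure_isFinite.Build _ _ _ tv tv_fin.

End total_variation.

Section lebesgue_decomposition.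
Local Open Scope ereal_scope.
Local Open Scope charge_scope.
Context d (T : measurableType d) (R : realType) (I : finType).
Variables (mu : I -> {charge set T -> \bar R}).
Variable lam : {sigma_finite_measure set T -> \bar R}.

(* Z carries the singular part of mu with respect to lam *)
Definition singular_carrier (Z : set T) := [/\ measurable Z, lam Z = 0 &
  forall A, measurable A -> lam A = 0 -> forall i, mu i (A `\` Z) = 0].

Lemma singular_carrier_exists : exists Z, singular_carrier Z.
Proof.
pose null := [set Z | measurable Z /\ lam Z = 0].
set s := ereal_sup [set tv mu Z | Z in null].
have null0 : null set0 by split.
have s_fin : s \is a fin_num.
  rewrite ge0_fin_numE; last first.
    by apply: ereal_sup_ubound; exists set0 => //; rewrite measure0.
  apply: (@le_lt_trans _ _ (tv mu setT)); last first.
    by rewrite ltey_eq fin_num_measure.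
  by apply: ge_ereal_sup => _ [Z [mZ _] <-]; rewrite le_measure// inE.
have /choice[Z HZ] : forall n, exists Z, null Z /\ s - n.+1%:R^-1%:E < tv mu Z.
  move=> n; have n0 : (0 < n.+1%:R^-1 :> R)%R by [].
  by have [_ [Z nZ <-] sZ] := ub_ereal_sup_adherent n0 s_fin; exists Z.
pose Y := \bigcup_n Z n.
have mY : measurable Y by apply: bigcup_measurable => n _; case: (HZ n) => -[].
have Y0 : lam Y = 0.
  apply/eqP; rewrite -measure_le0.
  have mZ n : measurable (Z n) by case: (HZ n) => -[].
  rewrite (le_trans (generalized_Boole_inequality lam mZ mY))//.
  by rewrite eseries0// => n _ _; case: (HZ n) => -[].
have sY : s <= tv mu Y.
  apply/lee_addgt0Pr => e e0.
  have [n ne] : exists n, (n.+1%:R^-1 < e)%R.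
    by have [n _ /(_ _ (leqnn n))] := near_infty_natSinv_lt (PosNum e0); exists n.
  have [[mZ _] sZ] := HZ n.
  rewrite -leeBlDr// ltW// (le_lt_trans _ (lt_le_trans sZ _))//.
    by rewrite leeB// lee_fin ltW.
  by rewrite le_measure ?inE//; exact: bigcup_sup.
exists Y; split => // A mA A0 i.
have mAY : measurable (A `\` Y) by exact: measurableD.
have : tv mu (Y `|` (A `\` Y)) <= s.
  apply: ereal_sup_ubound; exists (Y `|` (A `\` Y)) => //; split.
    exact: measurableU.
  by apply: null_set_setU => //; apply: subset_measure0 A0.
rewrite measureU//; last by rewrite setDE setIC -setIA setICl setI0.
move=> YAs; have : tv mu (A `\` Y) <= 0.
  have Yfin : tv mu Y \is a fin_num by exact: fin_num_measure.
  by rewrite -(@leeD2lE _ (tv mu Y))// adde0 (le_trans YAs).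
move=> AY0; have := le_trans (vnorm_le_tv mu mAY) AY0.
rewrite lee_fin => n0; have {n0} n0 : enorm (fun i => fine (mu i (A `\` Y))) = 0%R.
  by apply/eqP; rewrite eq_le n0 enorm_ge0.
have : (fine (mu i (A `\` Y)) ^+ 2 <= 0)%R.
  rewrite -[leRHS](expr0n _ 2) -n0 sqr_enorm (bigD1 i)//= lerDl.
  by apply: sumr_ge0 => j _; exact: sqr_ge0.
move=> n2; have : (fine (mu i (A `\` Y)) ^+ 2 == 0)%R.
  by rewrite eq_le n2 sqr_ge0.
rewrite sqrf_eq0 => /eqP mui0.
by rewrite -[LHS]fineK ?fin_num_measure// mui0.
Qed.

Definition singular_set : set T := sval (cid singular_carrier_exists).

Lemma singular_setP : singular_carrier singular_set.
Proof. exact: svalP (cid singular_carrier_exists). Qed.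

Lemma measurable_singular_set : measurable singular_set.
Proof. by have [] := singular_setP. Qed.

Definition ac_part (i : I) : {charge set T -> \bar R} :=
  crestr (mu i) (measurableC measurable_singular_set).

Definition singular_part (i : I) : {charge set T -> \bar R} :=
  crestr (mu i) measurable_singular_set.

Definition ac_density (i : I) (x : T) : R := fine ('d (ac_part i) '/d lam x).

Definition polar_density (i : I) (x : T) : R :=
  fine ('d (singular_part i) '/d (tv singular_part) x).

End lebesgue_decomposition.

Section charge_integral.
Local Open Scope ereal_scope.
Context d (T : measurableType d) (R : realType).
Variable nu : {charge set T -> \bar R}.

(* any Hahn decomposition gives the same integral (Hahn_decomposition_uniq) *)
Definition charge_integral (h : T -> \bar R) : \bar R :=
  let nuPN := svalP (cid (svalP (cid (Hahn_decomposition nu)))) in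
  \int[jordan_pos nuPN]_x h x - \int[jordan_neg nuPN]_x h x.

End charge_integral.

Section plane_analysis.
Context {R : realType}.
Implicit Types (phi : R * R -> R) (Omega : set (R * R)).

Definition basis_vec (i : 'I_2) : R * R := if i == 0 then (1, 0) else (0, 1).

Definition partial (i : 'I_2) phi (x : R * R) : R := 'D_(basis_vec i) phi x.

Fixpoint Cn (n : nat) phi : Prop :=
  continuous phi /\
  if n is m.+1 then
    forall i, (forall x, derivable phi x (basis_vec i)) /\ Cn m (partial i phi)
  else True.

Definition test_function Omega phi : Prop :=
  (forall n, Cn n phi) /\
  exists K : set (R * R),
    [/\ compact K, K `<=` Omega & forall x, ~ K x -> phi x = 0].

(* near each boundary point, Omega is, in coordinates (xi, eta) obtained by the
   rotation of matrix [[c, s], [-s, c]], the part of a square lying above the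
   graph of a Lipschitz function *)
Definition lipschitz_boundary Omega : Prop :=
  forall p : R * R, (closure Omega `\` interior Omega) p ->
  exists c s r L : R, exists gamma : R -> R,
    [/\ c ^+ 2 + s ^+ 2 = 1, 0 < r,
        forall a b, `|gamma a - gamma b| <= L * `|a - b| &
        forall x : R * R,
          let xi := c * (x.1 - p.1) + s * (x.2 - p.2) in
          let eta := c * (x.2 - p.2) - s * (x.1 - p.1) in
          `|xi| < r -> `|eta| < r -> (Omega x <-> gamma xi < eta)].

End plane_analysis.

Definition strictly_convex {R : realType} {V : lmodType R} (f : V -> R) : Prop :=
  forall x y, x != y -> forall t : R, 0 < t < 1 ->
    f (t *: x + (1 - t) *: y) < t * f x + (1 - t) * f y.

Definition recession {R : realType} {V : lmodType R} (g : V -> R) (x : V) : R :=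
  lim (g (t *: x) / t @[t --> +oo]).

Definition minimiser {R : realType} {X : Type} (E : X -> \bar R) (u : X) : Prop :=
  forall w : X, (E u <= E w)%E.

Section convex_function_of_measure.
Local Open Scope ereal_scope.
Context d (T : measurableType d) (R : realType) (m n : nat).

(* matrices are identified with row vectors by mxvec *)
Definition convex_of_measure (lam : {sigma_finite_measure set T -> \bar R})
    (g : 'rV[R]_(m * n) -> R) (mu : 'I_m * 'I_n -> {charge set T -> \bar R})
    (Omega : set T) : \bar R :=
  \int[lam]_(x in Omega)
    (g (mxvec (\matrix_(i, j) ac_density mu lam (i, j) x)))%:E +
  \int[tv (singular_part mu lam)]_(x in Omega)
    (recession g (mxvec (\matrix_(i, j) polar_density mu lam (i, j) x)))%:E.

End convex_function_of_measure.

Section bounded_hessian.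
Local Open Scope ereal_scope.
Context {R : realType} {Omega : set (R * R)} (oOmega : open Omega).

Definition leb_on : set (plane R) -> \bar R :=
  mrestr leb2 (open_measurable_plane oOmega).

HB.instance Definition _ := Measure.on leb_on.

(* u in W^{1,1}(Omega) whose weak gradient is in BV(Omega)^2. The gradient and
   the matrix-valued measure D(grad u), determined by u up to negligible sets,
   are carried along with u. Functions are defined on the whole plane but only
   their values on Omega matter. *)
Record BH := {
  BH_fun :> R * R -> R;
  BH_grad : R * R -> 'rV[R]_2;
  BH_hess : 'I_2 * 'I_2 -> {charge set (plane R) -> \bar R};
  BH_fun_L1 : (BH_fun : plane R -> R) \in Lfun leb_on 1;
  BH_grad_L1 : forall i,
    ((fun x => BH_grad x 0%R i) : plane R -> R) \in Lfun leb_on 1;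
  BH_weak_grad : forall i phi, test_function Omega phi ->
    \int[leb_on]_x (BH_fun x * partial i phi x)%:E =
    - \int[leb_on]_x (BH_grad x 0%R i * phi x)%:E;
  BH_hess_on : forall i j A, measurable A ->
    BH_hess (i, j) A = BH_hess (i, j) (A `&` Omega);
  BH_weak_hess : forall i j phi, test_function Omega phi ->
    \int[leb_on]_x (BH_grad x 0%R i * partial j phi x)%:E =
    - charge_integral (BH_hess (i, j)) (EFin \o phi)
}.

(* A bounded linear operator on L^2, acting on representatives. *)
Record bounded_linear_L2 (T : (R * R -> R) -> R * R -> R) : Prop := {
  L2_stable : forall u : plane R -> R,
    u \in Lfun leb_on 2%:E -> (T u : plane R -> R) \in Lfun leb_on 2%:E;
  L2_linear : forall (a : R) (u v : plane R -> R),
    u \in Lfun leb_on 2%:E -> v \in Lfun leb_on 2%:E ->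
    ae_eq leb_on setT (T (fun x => a * u x + v x)%R)
                      (fun x => a * T u x + T v x)%R;
  L2_bounded : exists C : R, forall u : plane R -> R,
    u \in Lfun leb_on 2%:E ->
    'N[leb_on]_2%:E[EFin \o (T u : plane R -> R)] <=
    C%:E * 'N[leb_on]_2%:E[EFin \o u]
}.

Definition injective_L2 (T : (R * R -> R) -> R * R -> R) : Prop :=
  forall u v : plane R -> R,
    u \in Lfun leb_on 2%:E -> v \in Lfun leb_on 2%:E ->
    ae_eq leb_on setT (T u) (T v) -> ae_eq leb_on setT u v.

(* BH(Omega) is contained in L^2(Omega) when Omega is a bounded Lipschitz
   domain, the only case where Hex is used; the value +oo is the usual
   convention outside of the domain of T. *)
Definition fidelity (T : (R * R -> R) -> R * R -> R) (u0 : R * R -> R)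
    (u : plane R -> R) : \bar R :=
  if u \in Lfun leb_on 2%:E
  then 2^-1%:E * \int[leb_on]_x ((u0 x - T u x) ^+ 2)%:E else +oo.

Definition Hex (T : (R * R -> R) -> R * R -> R) (u0 : R * R -> R)
    (alpha beta : R) (f : 'rV[R]_2 -> R) (g : 'rV[R]_4 -> R) (u : BH) : \bar R :=
  fidelity T u0 u +
  alpha%:E * \int[leb_on]_x (f (BH_grad u x))%:E +
  beta%:E * @convex_of_measure _ _ R 2 2 leb2 g (BH_hess u) Omega.

End bounded_hessian.

(* Main.v *)
Require Import Defs.
From HB Require Import structures.
From mathcomp Require Import all_boot all_order all_algebra.
From mathcomp Require Import all_classical all_reals all_analysis.
From mathcomp Require Import measurable_realfun.
From mathcomp Require Import ring lra.
Set Implicit Arguments.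
Unset Strict Implicit.
Unset Printing Implicit Defensive.
Import Order.TTheory GRing.Theory Num.Theory.
Import numFieldNormedType.Exports.
Local Open Scope classical_set_scope.
Local Open Scope ring_scope.

(** Let [u] and [v] be two minimisers and [w] their average, which is again in
    [BH] ([BH_midpoint]). The energy is a sum of three terms that are convex
    along the segment from [u] to [v]; as [u] and [v] are minimal, none of the
    three may be below its average value at [w] ([convex_energy_gap]).

    For the data term, the gap to the average is a multiple of the squared norm
    of [T u - T v] by the parallelogram identity ([misfit_parallelogram]), so
    [T u = T v] almost everywhere, and an injective [T] gives [u = v]. For the
    gradient term, the absence of a gap means that the midpoint inequality for
    [f] is an equality at the two gradients almost everywhere; if [f] is
    strictly convex, the gradients agree ([grad_energy_strict]). Then [u - v]
    has zero weak gradient, so it is a constant [k] on the connected set [Omega]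
    ([weak_grad0_cst]), and [k * T \1_Omega = T u - T v = 0] with
    [T \1_Omega <> 0] gives [k = 0].

    Two steps need a proper theory. The first is the convexity of the measure
    term [g(D^2 u)(Omega)] ([convex_of_measure_midpoint]). The three Hessians
    have different singular parts, each with its own polar decomposition; but
    the recession function of [g] is positively homogeneous, so the singular
    term can be computed with the density with respect to any measure that
    dominates the total variation ([integral_polar_density]). With one measure
    that dominates all the singular parts, convexity becomes a pointwise
    inequality. Linear growth enters here: it makes a convex function
    Lipschitz, hence measurable along densities and with a finite recession
    function.

    The second is that a function [h] with zero weak gradient is locally
    constant. It is tested with products [A x * B y] where [A'] tends to the
    difference of the normalised indicators of two intervals and [B] tends to
    an indicator. In the limit the integral of [h] over a box is proportional
    to the side of the box in the first variable; the same in the second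
    variable shows that it is proportional to the area. So [h] minus its mean
    has zero integral on all boxes of a small square, hence vanishes almost
    everywhere there. *)

(** * Convex functions of linear growth *)

Lemma cvg_inv_pinfty (R : realType) : t^-1 @[t --> +oo] --> (0 : R).
Proof.
have p : \forall t \near +oo, 0 < (t : R) by exact: nbhs_pinfty_gt.
by apply/(gtr0_cvgV0 p); exact: cvg_id.
Qed.

Section linear_growth.
Context {R : realType} {n : nat}.
Implicit Types (x y : 'rV[R]_n) (g : 'rV[R]_n -> R).

Definition l1norm x : R := \sum_i `|x 0 i|.

Lemma l1norm_ge0 x : 0 <= l1norm x.
Proof. exact: sumr_ge0. Qed.

Lemma l1normD x y : l1norm (x + y) <= l1norm x + l1norm y.
Proof.
by rewrite -big_split/=; apply: ler_sum => i _; rewrite mxE ler_normD.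
Qed.

Lemma l1normZ (a : R) x : l1norm (a *: x) = `|a| * l1norm x.
Proof. by rewrite mulr_sumr; apply: eq_bigr => i _; rewrite mxE normrM. Qed.

Lemma enorm_le_l1norm x : enorm (x 0) <= l1norm x.
Proof.
have [c [c1 _ <-]] := enorm_dual (x 0).
apply: ler_sum => i _; rewrite (le_trans (ler_norm _))// normrM.
by rewrite ler_piMl.
Qed.

Lemma convex_functionP g : convex_function setT g ->
  forall t x y, 0 <= t <= 1 -> g (t *: x + (1 - t) *: y) <= t * g x + (1 - t) * g y.
Proof.
move=> gc t x y t01.
have := @gc (Itv01 (andP t01).1 (andP t01).2) x y.
by rewrite !in_setT => /(_ isT isT).
Qed.

Lemma convex_midpoint g : convex_function setT g -> forall x y,
  g (2^-1 *: x + 2^-1 *: y) <= 2^-1 * g x + 2^-1 * g y.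
Proof.
move=> gc x y; have := convex_functionP gc (t := 2^-1) x y.
have -> : 1 - 2^-1 = 2^-1 :> R by lra.
by apply; lra.
Qed.

Variables (g : 'rV[R]_n -> R) (K : R).
Hypothesis g_convex : convex_function setT g.
Hypothesis K0 : 0 <= K.
Hypothesis g_le : forall x, g x <= K * (1 + l1norm x).

(** Convexity bounds the increment from [x] to [y] by [s] times the increment
    from [x] to [x + (y - x) / s]. By the growth bound this is at most
    [K * l1norm (y - x)] plus [s] times a constant, and [s] may tend to 0. *)
Lemma convex_growth_lipschitz x y : g y <= g x + K * l1norm (y - x).
Proof.
set N := l1norm (y - x).
apply/ler_addgt0Pr => e e0.
pose M := K * (1 + l1norm x) + `|g x|.
have M0 : 0 <= M by rewrite addr_ge0// mulr_ge0// addr_ge0// l1norm_ge0.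
(* the constant is at most M, and s * M <= e with s <= 1 *)
pose s := e / (e + M).
have eM : 0 < e + M by rewrite ltr_wpDr.
have s0 : 0 < s by rewrite divr_gt0.
have s1 : s <= 1 by rewrite ler_pdivrMr// mul1r lerDl.
have sM : s * M <= e.
  by rewrite /s mulrAC ler_pdivrMr// ler_wpM2l ?(ltW e0)// lerDr ltW.
have := @convex_functionP g g_convex s (x + s^-1 *: (y - x)) x.
rewrite (ltW s0) s1 => /(_ isT).
have -> : s *: (x + s^-1 *: (y - x)) + (1 - s) *: x = y.
  rewrite scalerDr scalerA divff ?gt_eqF// scale1r scalerBl scale1r.
  by rewrite addrC addrA subrK addrC subrK.
move=> /le_trans; apply.
have h : g (x + s^-1 *: (y - x)) <= K * (1 + l1norm x) + K * (s^-1 * N).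
  rewrite (le_trans (g_le _))// -mulrDr ler_wpM2l// -addrA lerD2l.
  by rewrite (le_trans (l1normD _ _))// l1normZ ger0_norm// invr_ge0 ltW.
have : s * g (x + s^-1 *: (y - x)) <= s * (K * (1 + l1norm x)) + K * N.
  rewrite (le_trans (ler_wpM2l (ltW s0) h))// mulrDr lerD2l.
  by rewrite mulrCA [s * _]mulrA divff ?gt_eqF// mul1r.
have : s * (K * (1 + l1norm x)) + s * `|g x| <= e by rewrite -mulrDr.
have : - (s * g x) <= s * `|g x|.
  by rewrite -mulrN ler_wpM2l ?(ltW s0)// -normrN ler_norm.
rewrite mulrBl mul1r; lra.
Qed.

Lemma convex_growth_lipschitz_norm x y : `|g y - g x| <= K * l1norm (y - x).
Proof.
have H := convex_growth_lipschitz.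
rewrite ler_norml; apply/andP; split; last by rewrite lerBlDl H.
have -> : l1norm (y - x) = l1norm (x - y).
  by rewrite -opprB -scaleN1r l1normZ normrN1 mul1r.
by rewrite lerNl opprB lerBlDl H.
Qed.

Let quot x (t : R) := (g (t *: x) - g 0) / t.

Let quot_nd x s t : 0 < s -> s <= t -> quot x s <= quot x t.
Proof.
move=> s0 st; have t0 := lt_le_trans s0 st.
have := @convex_functionP g g_convex (s / t) (t *: x) 0.
rewrite divr_ge0 ?(ltW s0) ?(ltW t0)// ler_pdivrMr// mul1r st => /(_ isT).
rewrite scaler0 addr0 scalerA divfK ?gt_eqF// => h.
rewrite /quot ler_pdivrMr//.
have -> : (g (t *: x) - g 0) / t * s = s / t * g (t *: x) + (1 - s / t) * g 0 - g 0.
  by field; rewrite gt_eqF.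
by rewrite lerD2r.
Qed.

(** By convexity the slopes of [g] from the origin increase along a ray, and
    the Lipschitz bound keeps them bounded. *)
Lemma recession_cvg x : g (t *: x) / t @[t --> +oo] --> recession g x.
Proof.
suff : cvg (g (t *: x) / t @[t --> +oo]) by [].
(* the slope is monotone for positive t only: it is frozen below 1 *)
pose psi t := quot x (Num.max t 1).
have psi_cvg : psi t @[t --> +oo] --> sup (range psi).
  apply: nondecreasing_cvgr => [s t st|].
    by apply: quot_nd; rewrite ?lt_max ?ltr01 ?orbT// ge_max !le_max st lexx !orbT.
  exists (K * l1norm x) => _ [t _ <-]; rewrite /psi.
  have m0 : 0 < Num.max t 1 by rewrite lt_max ltr01 orbT.
  rewrite /quot ler_pdivrMr// lerBlDl.
  rewrite (le_trans (convex_growth_lipschitz 0 _))// lerD2l subr0 l1normZ.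
  by rewrite gtr0_norm// mulrCA mulrC.
have inv_cvg : g 0 / t @[t --> +oo] --> (0 : R).
  rewrite -[X in _ --> X](mulr0 (g 0)); apply: cvgMl_tmp.
  exact: cvg_inv_pinfty.
have psi_inv_cvg : psi t + g 0 / t @[t --> +oo] --> sup (range psi) + 0.
  exact: cvgD psi_cvg inv_cvg.
apply: (cvgP (sup (range psi) + 0)); apply: cvg_trans psi_inv_cvg.
apply: near_eq_cvg.
near=> t; have t1 : 1 <= t by near: t; exact: nbhs_pinfty_ge.
by rewrite /psi /quot max_l// -mulrDl subrK.
Unshelve. all: end_near. Qed.

Lemma recession_ge0 x : (forall y, 0 <= g y) -> 0 <= recession g x.
Proof.
move=> g0; apply: limr_ge; first exact: (cvgP _ (@recession_cvg x)).
near=> t; rewrite divr_ge0//.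
Unshelve. all: end_near. Qed.

Lemma recession_midpoint x y :
  recession g (2^-1 *: x + 2^-1 *: y) <= 2^-1 * recession g x + 2^-1 * recession g y.
Proof.
have cvl := @recession_cvg (2^-1 *: x + 2^-1 *: y).
have cvr : 2^-1 * (g (t *: x) / t) + 2^-1 * (g (t *: y) / t) @[t --> +oo] -->
    2^-1 * recession g x + 2^-1 * recession g y.
  by apply: cvgD; (apply: cvgMl_tmp; exact: recession_cvg).
apply: (ler_cvg_to cvl cvr).
near=> t; have t0 : 0 < t by near: t; exact: nbhs_pinfty_gt.
rewrite !mulrA -mulrDl ler_pM2r ?invr_gt0//.
have := convex_midpoint g_convex (t *: x) (t *: y).
by rewrite scalerDr !scalerA !(mulrC t).
Unshelve. all: end_near. Qed.

Lemma recessionZ (r : R) x : 0 <= r -> recession g (r *: x) = r * recession g x.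
Proof.
rewrite le_eqVlt => /predU1P[<-|r0].
  rewrite scale0r mul0r; apply/cvg_lim => //.
  have : g 0 * t^-1 @[t --> +oo] --> g 0 * 0.
    by apply: cvgMl_tmp; exact: cvg_inv_pinfty.
  rewrite mulr0; apply: cvg_trans; apply: near_eq_cvg.
  by apply: nearW => t; rewrite scaler0.
apply/cvg_lim => //.
have rt : r * t @[t --> +oo] --> +oo.
  apply/cvgryPge => A; near=> t.
  rewrite mulrC -ler_pdivrMr//; near: t; exact: nbhs_pinfty_ge.
have := cvg_comp _ _ rt (@recession_cvg x).
move=> /(@cvgMl_tmp _ _ _ _ _ r); apply: cvg_trans; apply: near_eq_cvg.
near=> t; have t0 : 0 < t by near: t; exact: nbhs_pinfty_gt.
by rewrite /= scalerA (mulrC r t) invfM mulrCA (mulrC r) -!mulrA mulVf ?gt_eqF// mulr1.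
Unshelve. all: end_near. Qed.

Lemma recession_lipschitz x y :
  `|recession g y - recession g x| <= K * l1norm (y - x).
Proof.
have cv : `|g (t *: y) / t - g (t *: x) / t| @[t --> +oo] -->
    `|recession g y - recession g x|.
  by apply: cvg_norm; apply: cvgB; exact: recession_cvg.
apply: (ler_cvg_to cv (cvg_cst _)).
near=> t; have t0 : 0 < t by near: t; exact: nbhs_pinfty_gt.
rewrite -mulrBl normrM (gtr0_norm (_ : 0 < t^-1)) ?invr_gt0// ler_pdivrMr//.
rewrite (le_trans (convex_growth_lipschitz_norm _ _))// -scalerBr l1normZ.
by rewrite gtr0_norm// mulrCA mulrC.
Unshelve. all: end_near. Qed.

End linear_growth.

Lemma l1norm_rat_approx (R : realType) n (x : 'rV[R]_n) (e : R) : 0 < e ->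
  exists q : 'rV[rat]_n, l1norm (x - map_mx ratr q) < e.
Proof.
move=> e0; pose d := e / (n.+1)%:R.
have d0 : 0 < d by rewrite divr_gt0.
have /choice[q Hq] : forall i, exists q : rat, `|x 0 i - ratr q| < d.
  move=> i; have [|q] := @rat_in_itvoo R (x 0 i - d) (x 0 i + d).
    by rewrite ltrD2l gt0_cp.
  rewrite in_itv/= => /andP[q1 q2]; exists q.
  by rewrite ltr_norml; apply/andP; split; lra.
exists (\row_i q i); rewrite /l1norm.
apply: (@le_lt_trans _ _ (\sum_(i < n) d)).
  by apply: ler_sum => i _; rewrite !mxE ltW.
rewrite sumr_const card_ord -mulr_natr /d mulrAC ltr_pdivrMr//.
by rewrite ltr_pM2l// ltr_nat.
Qed.

Lemma measurable_l1norm d (T : measurableType d) (R : realType) n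
    (h : T -> 'rV[R]_n) (q : 'rV[R]_n) :
  (forall i, measurable_fun setT (fun x => h x 0 i)) ->
  measurable_fun setT (fun x => l1norm (h x - q)).
Proof.
move=> mh; apply: measurable_sum => i; apply: measurableT_comp => //.
by under eq_fun do rewrite !mxE; apply: measurable_funB.
Qed.

(** [F (h x)] is the supremum over rational points [q] of
    [F q - M * l1norm (h x - q)], so its superlevel sets are countable unions of
    superlevel sets of these measurable functions. *)
Lemma measurable_lipschitz_comp d (T : measurableType d) (R : realType) n
    (F : 'rV[R]_n -> R) (L : R) (h : T -> 'rV[R]_n) :
  (forall x y, `|F y - F x| <= L * l1norm (y - x)) ->
  (forall i, measurable_fun setT (fun x => h x 0 i)) ->
  measurable_fun setT (F \o h).
Proof.
move=> FL mh.
pose M := Num.max L 1.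
have M0 : 0 < M by rewrite lt_max ltr01 orbT.
have {}FL x y : `|F y - F x| <= M * l1norm (y - x).
  by rewrite (le_trans (FL x y))// ler_wpM2r ?l1norm_ge0// le_max lexx.
apply: (measurability _ (RGenOInfty.measurableE R)) => /= _ [_ [a ->] <-].
pose G (q : 'rV[rat]_n) x := F (map_mx ratr q) - M * l1norm (h x - map_mx ratr q).
have -> : setT `&` (F \o h) @^-1` `]a, +oo[ =
    \bigcup_q (setT `&` [set x | a < G q x]).
  apply/seteqP; split => [x [_ /=]|x [q _ [_ /=]]].
    rewrite in_itv/= andbT => aF.
    pose e := (F (h x) - a) / (M + M).
    have e0 : 0 < e by rewrite divr_gt0 ?subr_gt0// addr_gt0.
    have [q qe] := l1norm_rat_approx (h x) e0.
    exists q => //; split => //=; rewrite /G.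
    have := FL (map_mx ratr q) (h x).
    move: qe; rewrite /e ltr_pdivlMr ?addr_gt0// => qe /(le_trans (ler_norm _)).
    lra.
  rewrite in_itv/= andbT /G => aG.
  have := FL (map_mx ratr q) (h x).
  by rewrite ler_norml => /andP[]; lra.
apply: countable_bigcupT_measurable => // q.
apply: measurable_fun_ltr => //.
apply: measurable_funB => //; apply: measurable_funM => //.
exact: measurable_l1norm.
Qed.

Lemma integrable_lipschitz_comp d (T : measurableType d) (R : realType) n
    (mu : {measure set T -> \bar R}) (D : set T)
    (F : 'rV[R]_n -> R) (L : R) (h : T -> 'rV[R]_n) :
  measurable D -> (mu D < +oo)%E ->
  (forall x, 0 <= F x) ->
  (forall x y, `|F y - F x| <= L * l1norm (y - x)) ->
  (forall i, measurable_fun setT (fun x => h x 0 i)) ->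
  (forall i, mu.-integrable D (fun x => (h x 0 i)%:E)) ->
  mu.-integrable D (fun x => (F (h x))%:E).
Proof.
move=> mD muD F0 FL mh ih.
have iF0 : mu.-integrable D (fun=> (F 0)%:E).
  apply/integrableP; split => //=.
  by rewrite integral_cst// lte_mul_pinfty.
have il : mu.-integrable D (fun x => (L * l1norm (h x))%:E).
  rewrite [X in mu.-integrable _ X](_ : _ =
      (fun x => L%:E * (\sum_i `|(h x 0 i)%:E|))%E); last first.
    by apply/funext => x; rewrite sumEFin -EFinM.
  apply: integrableZl => //; apply: (integrable_sum mD) => i _.
  exact: integrable_abse (ih i).
apply: le_integrable (integrableD mD iF0 il) => //.
  apply/measurable_EFinP; apply: measurable_funTS.
  exact: measurable_lipschitz_comp FL mh.
move=> x _; rewrite -EFinD !abse_EFin lee_fin (ger0_norm (F0 _)).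
rewrite (le_trans _ (ler_norm _))//; have := FL 0 (h x).
by rewrite subr0 => /(le_trans (ler_norm _)); rewrite lerBlDl.
Qed.

(** * Densities, singular parts and polar decompositions *)

Section charge_density.
Local Open Scope ereal_scope.
Local Open Scope charge_scope.
Context d (T : measurableType d) (R : realType).
Implicit Types (nu : {charge set T -> \bar R})
  (lam : {sigma_finite_measure set T -> \bar R}).

Definition density nu lam (x : T) : R := fine ('d nu '/d lam x).

Lemma EFin_density nu lam x : nu `<< lam -> (density nu lam x)%:E = 'd nu '/d lam x.
Proof. by move=> nulam; rewrite fineK// Radon_Nikodym_fin_num. Qed.

Lemma density_integrable nu lam : nu `<< lam ->
  lam.-integrable setT (EFin \o density nu lam).
Proof.
move=> nulam; apply: eq_integrable (Radon_Nikodym_integrable nulam) => //.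
by move=> x _; rewrite /= EFin_density.
Qed.

Lemma measurable_density nu lam : nu `<< lam -> measurable_fun setT (density nu lam).
Proof.
by move=> nulam; apply/measurable_EFinP; exact/measurable_int/density_integrable.
Qed.

Lemma density_integral nu lam A : nu `<< lam -> measurable A ->
  nu A = \int[lam]_(x in A) (density nu lam x)%:E.
Proof.
move=> nulam mA; rewrite (Radon_Nikodym_integral nulam mA).
by apply: eq_integral => x _; rewrite EFin_density.
Qed.

Definition charge_midpoint (nu nu1 nu2 : {charge set T -> \bar R}) :=
  forall A, measurable A -> nu A = 2^-1%:E * nu1 A + 2^-1%:E * nu2 A.

Lemma density_midpoint nu nu1 nu2 lam :
  nu `<< lam -> nu1 `<< lam -> nu2 `<< lam -> charge_midpoint nu nu1 nu2 ->
  {ae lam, forall x, density nu lam x =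
    (2^-1 * density nu1 lam x + 2^-1 * density nu2 lam x)%R}.
Proof.
move=> nul nu1l nu2l nuE.
have i1 := density_integrable nu1l; have i2 := density_integrable nu2l.
have j1 := integrableZl measurableT 2^-1%R i1.
have j2 := integrableZl measurableT 2^-1%R i2.
suff : ae_eq lam setT (EFin \o density nu lam)
    ((fun x => 2^-1%:E * (density nu1 lam x)%:E) \+
     (fun x => 2^-1%:E * (density nu2 lam x)%:E)).
  apply: filterS => x /(_ Logic.I) /=.
  by rewrite -!EFinM -EFinD => -[].
apply: integral_ae_eq => //.
- exact: density_integrable.
- by apply: emeasurable_funD; [exact: measurable_int j1|exact: measurable_int j2].
- move=> A _ mA; rewrite integralD//; try exact: integrableS (measurableT) _ _ _.
  rewrite integralZl//; last exact: integrableS (measurableT) _ _ i1.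
  rewrite integralZl//; last exact: integrableS (measurableT) _ _ i2.
  by rewrite -!density_integral// nuE.
Qed.

End charge_density.

Section convex_of_measure_midpoint.
Local Open Scope ereal_scope.
Local Open Scope charge_scope.
Context d (T : measurableType d) (R : realType) (I : finType).
Variable lam : {sigma_finite_measure set T -> \bar R}.
Implicit Types (mu : I -> {charge set T -> \bar R}).

Lemma tv_eq0 mu A : measurable A ->
  (forall B, measurable B -> B `<=` A -> forall i, mu i B = 0) -> tv mu A = 0.
Proof.
move=> mA muA; apply/eqP; rewrite eq_le measure_ge0 andbT {1}/tv mem_set//.
apply: ge_ereal_sup => _ /= [F [mF tF FA] <-].
rewrite eseries0// => k _ _; rewrite /vnorm enorm0// => i.
by rewrite muA// -FA; exact: bigcup_sup.
Qed.

Lemma dominates_tv mu i : mu i `<< tv mu.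
Proof.
apply/null_content_dominatesP => A mA tvA0.
have := vnorm_le_tv mu mA; rewrite [X in _ <= X]tvA0 /vnorm lee_fin => n0.
have {}n0 : enorm (fun j => fine (mu j A)) = 0%R.
  by apply/eqP; rewrite eq_le n0 enorm_ge0.
have : (fine (mu i A) ^+ 2 <= 0)%R.
  rewrite -[leRHS](expr0n _ 2) -n0 sqr_enorm (bigD1 i)//= lerDl.
  by apply: sumr_ge0 => j _; exact: sqr_ge0.
rewrite -[mu i A]fineK ?fin_num_measure// => n2; congr EFin; apply/eqP.
by rewrite -sqrf_eq0 eq_le n2 sqr_ge0.
Qed.

Lemma tv_dominates mu (tau : {measure set T -> \bar R}) :
  (forall i, mu i `<< tau) -> tv mu `<< tau.
Proof.
move=> mutau; apply/null_content_dominatesP => A mA tauA0.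
apply: tv_eq0 => // B mB BA i.
have /null_content_dominatesP := mutau i; apply => //.
exact: subset_measure0 tauA0.
Qed.

Lemma ac_part_dominates mu i : ac_part mu lam i `<< lam.
Proof.
apply/null_content_dominatesP => A mA A0.
by have [_ _ /(_ A mA A0 i)] := singular_setP mu lam.
Qed.

(** The singular carrier can be replaced by any larger null set. This allows
    charges with different carriers to be compared outside a common one. *)
Lemma ac_part_setD mu i N A : measurable N -> measurable A ->
  lam N = 0 -> singular_set mu lam `<=` N -> ac_part mu lam i A = mu i (A `\` N).
Proof.
move=> mN mA N0 ZN; have [mZ _ HZ] := singular_setP mu lam.
set Z := singular_set mu lam in mZ HZ ZN *.
rewrite /ac_part /= /crestr -setDE (chargeDI (mu i) (measurableD mA mZ) mN).
have -> : (A `\` Z) `&` N = (A `&` N) `\` Z by rewrite setIC setIDA setIC.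
rewrite setDDl (setUidr ZN) HZ ?adde0//; first exact: measurableI.
by apply: subset_measure0 N0 => //; exact: measurableI.
Qed.

Lemma ac_part_midpoint mu mu1 mu2 i :
  (forall i, charge_midpoint (mu i) (mu1 i) (mu2 i)) ->
  charge_midpoint (ac_part mu lam i) (ac_part mu1 lam i) (ac_part mu2 lam i).
Proof.
move=> muE A mA.
pose Z (m : I -> {charge set T -> \bar R}) := singular_set m lam.
have mZ m : measurable (Z m) by exact: measurable_singular_set.
have Z0 m : lam (Z m) = 0 by have [] := singular_setP m lam.
pose N := Z mu `|` (Z mu1 `|` Z mu2).
have mZ12 : measurable (Z mu1 `|` Z mu2) by exact: measurableU.
have mN : measurable N by exact: measurableU.
have N0 : lam N = 0.
  have Z12 := null_set_setU (mZ mu1) (mZ mu2) (Z0 mu1) (Z0 mu2).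
  exact: null_set_setU (mZ mu) mZ12 (Z0 mu) Z12.
rewrite !(@ac_part_setD _ _ N)//.
- by rewrite muE//; exact: measurableD.
- by move=> x; right; right.
- by move=> x; right; left.
- by move=> x; left.
Qed.

Lemma ac_singular_partE mu i A : measurable A ->
  mu i A = ac_part mu lam i A + singular_part mu lam i A.
Proof.
move=> mA; rewrite /ac_part /singular_part /= /crestr -setDE.
exact/chargeDI/measurable_singular_set.
Qed.

Lemma singular_part_midpoint mu mu1 mu2 i :
  (forall i, charge_midpoint (mu i) (mu1 i) (mu2 i)) ->
  charge_midpoint (singular_part mu lam i) (singular_part mu1 lam i)
    (singular_part mu2 lam i).
Proof.
move=> muE A mA; have := ac_part_midpoint i muE mA; have := muE i A mA.
rewrite (ac_singular_partE mu) // (ac_singular_partE mu1) // (ac_singular_partE mu2) //.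
have finE (m : I -> {charge set T -> \bar R}) :
    (ac_part m lam i A = (fine (ac_part m lam i A))%:E) *
    (singular_part m lam i A = (fine (singular_part m lam i A))%:E).
  by rewrite !fineK ?fin_num_measure.
rewrite (finE mu).1 (finE mu).2 (finE mu1).1 (finE mu1).2 (finE mu2).1 (finE mu2).2.
rewrite -!EFinD => -[E1] [E2]; congr EFin; lra.
Qed.

End convex_of_measure_midpoint.

Section recession_integral.
Local Open Scope ereal_scope.
Local Open Scope charge_scope.
Context d (T : measurableType d) (R : realType) (m n : nat).
Notation I := ('I_m * 'I_n)%type.

Definition vec_of (y : I -> R) : 'rV[R]_(m * n) := mxvec (\matrix_(i, j) y (i, j)).

Lemma vec_ofE y i j : vec_of y 0%R (mxvec_index i j) = y (i, j).
Proof. by rewrite /vec_of mxvecE mxE. Qed.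

Lemma vec_ofZ (a : R) y : vec_of (fun k => a * y k)%R = (a *: vec_of y)%R.
Proof.
rewrite /vec_of -linearZ/=; congr mxvec.
by apply/matrixP => i j; rewrite !mxE.
Qed.

Lemma vec_of_midpoint y y1 y2 : (forall k, y k = 2^-1 * y1 k + 2^-1 * y2 k)%R ->
  vec_of y = (2^-1 *: vec_of y1 + 2^-1 *: vec_of y2)%R.
Proof.
move=> yE; rewrite /vec_of -!linearZ/= -linearD/=; congr mxvec.
by apply/matrixP => i j; rewrite !mxE.
Qed.

Lemma measurable_vec_of (y : T -> I -> R) k : (forall k, measurable_fun setT (y ^~ k)) ->
  measurable_fun setT (fun x => vec_of (y x) 0%R k).
Proof.
move=> my; case/mxvec_indexP: k => i j.
by under eq_fun do rewrite vec_ofE; exact: my.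
Qed.

Variables (G : 'rV[R]_(m * n) -> R) (L : R).
Hypothesis G_ge0 : forall x, (0 <= G x)%R.
Hypothesis G_lip : forall x y, (`|G y - G x| <= L * l1norm (y - x))%R.

Lemma measurable_density_comp (mu : I -> {charge set T -> \bar R})
    (lam : {sigma_finite_measure set T -> \bar R}) :
  (forall k, mu k `<< lam) ->
  measurable_fun setT (fun x => G (vec_of (fun k => density (mu k) lam x))).
Proof.
move=> mulam; apply: (measurable_lipschitz_comp G_lip) => i.
apply: (@measurable_vec_of (fun x k => density (mu k) lam x)) => k.
exact: measurable_density.
Qed.

Lemma integrable_density_comp (mu : I -> {charge set T -> \bar R})
    (lam : {sigma_finite_measure set T -> \bar R}) (D : set T) :
  measurable D -> lam D < +oo -> (forall k, mu k `<< lam) ->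
  lam.-integrable D (fun x => (G (vec_of (fun k => density (mu k) lam x)))%:E).
Proof.
move=> mD lamD mulam.
apply: (integrable_lipschitz_comp mD lamD G_ge0 G_lip) => i.
  apply: (@measurable_vec_of (fun x k => density (mu k) lam x)) => k.
  exact: measurable_density.
case/mxvec_indexP: i => i j.
apply: eq_integrable (integrableS measurableT mD (@subsetT _ D)
  (density_integrable (mulam (i, j)))) => //.
by move=> x _; rewrite vec_ofE.
Qed.

Hypothesis G_homog : forall (r : R) x, (0 <= r)%R -> G (r *: x) = (r * G x)%R.

(** The density of [sigma k] with respect to [tau] is its polar density times
    the density [r >= 0] of the total variation; homogeneity takes [r] out of
    [G], and [r] is absorbed by a change of measure. *)
Lemma integral_polar_density (sigma : I -> {charge set T -> \bar R})
    (tau : {sigma_finite_measure set T -> \bar R}) (D : set T) :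
  measurable D -> tv sigma `<< tau ->
  \int[tv sigma]_(x in D) (G (vec_of (fun k => density (sigma k) (tv sigma) x)))%:E =
  \int[tau]_(x in D) (G (vec_of (fun k => density (sigma k) tau x)))%:E.
Proof.
move=> mD tvtau.
have sigmatau k : sigma k `<< tau.
  exact: null_dominates_trans (@dominates_tv _ _ _ _ sigma k) tvtau.
have tvD : tv sigma D < +oo by rewrite ltey_eq fin_num_measure.
have intf := integrable_density_comp mD tvD (@dominates_tv _ _ _ _ sigma).
rewrite -(Radon_Nikodym_change_of_variables tvtau mD intf).
set r := 'd (charge_of_finite_measure (tv sigma)) '/d tau.
apply: ae_eq_integral => //.
- apply: measurable_funTS; apply: emeasurable_funM.
    by apply/measurable_EFinP; exact: measurable_density_comp (@dominates_tv _ _ _ _ sigma).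
  exact/measurable_int/Radon_Nikodym_integrable.
- by apply/measurable_EFinP; apply: measurable_funTS; exact: measurable_density_comp.
have chain : {ae tau, forall x, forall k : I, 'd (sigma k) '/d tau x =
    'd (sigma k) '/d (tv sigma) x * r x}.
  apply: filter_forall => k.
  have := Radon_Nikodym_chain_rule (@dominates_tv _ _ _ _ sigma k) tvtau.
  by apply: filterS => x; exact.
have := ae_eq_Radon_Nikodym_SigmaFinite tvtau measurableT.
apply: filterS2 chain => x chainx /(_ Logic.I) rx _.
have r0 : 0 <= r x by rewrite /r -rx; exact: Radon_Nikodym_SigmaFinite.f_ge0.
have rfin : r x \is a fin_num by rewrite Radon_Nikodym_fin_num.
rewrite -(fineK rfin) -EFinM; congr EFin.
rewrite mulrC -G_homog ?fine_ge0// -vec_ofZ; congr (G (vec_of _)).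
apply/funext => k; rewrite /density chainx fineM ?Radon_Nikodym_fin_num//.
  by rewrite mulrC.
exact: dominates_tv.
Qed.

End recession_integral.

(** * Convexity of the convex function of a measure *)

Section convex_of_measure.
Local Open Scope ereal_scope.
Local Open Scope charge_scope.
Context d (T : measurableType d) (R : realType).

Lemma ge0_integral_midpoint (mu : {measure set T -> \bar R}) (D : set T)
    (F1 F2 : T -> R) : measurable D ->
  (forall x, 0 <= F1 x)%R -> (forall x, 0 <= F2 x)%R ->
  measurable_fun D F1 -> measurable_fun D F2 ->
  \int[mu]_(x in D) (2^-1 * F1 x + 2^-1 * F2 x)%:E =
  2^-1%:E * \int[mu]_(x in D) (F1 x)%:E + 2^-1%:E * \int[mu]_(x in D) (F2 x)%:E.
Proof.
move=> mD F10 F20 mF1 mF2.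
have h0 : (0 <= 2^-1 :> R)%R by rewrite invr_ge0.
under eq_integral do rewrite EFinD 2!EFinM.
rewrite ge0_integralD//.
- rewrite !ge0_integralZl_EFin//; try exact/measurable_EFinP.
  + by move=> x _; rewrite lee_fin.
  + by move=> x _; rewrite lee_fin.
- by move=> x _; rewrite -EFinM lee_fin mulr_ge0.
- by apply: measurable_funeM; exact/measurable_EFinP.
- by move=> x _; rewrite -EFinM lee_fin mulr_ge0.
- by apply: measurable_funeM; exact/measurable_EFinP.
Qed.

Lemma ge0_integral_le_midpoint (mu : {measure set T -> \bar R}) (D : set T)
    (F F1 F2 : T -> R) : measurable D ->
  (forall x, 0 <= F x)%R -> (forall x, 0 <= F1 x)%R -> (forall x, 0 <= F2 x)%R ->
  measurable_fun D F -> measurable_fun D F1 -> measurable_fun D F2 ->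
  {ae mu, forall x, F x <= 2^-1 * F1 x + 2^-1 * F2 x}%R ->
  \int[mu]_(x in D) (F x)%:E <=
  2^-1%:E * \int[mu]_(x in D) (F1 x)%:E + 2^-1%:E * \int[mu]_(x in D) (F2 x)%:E.
Proof.
move=> mD F0 F10 F20 mF mF1 mF2 Fle.
rewrite -ge0_integral_midpoint//; apply: ae_ge0_le_integral => //.
- by move=> x _; rewrite lee_fin.
- exact/measurable_EFinP.
- by move=> x _; rewrite lee_fin addr_ge0// mulr_ge0.
- apply/measurable_EFinP; apply: measurable_funD; exact: measurable_funM.
- by apply: filterS Fle => x ? _; rewrite lee_fin.
Qed.

Lemma lee_midpointD (h a b a1 b1 a2 b2 : \bar R) :
  0 <= a1 -> 0 <= b1 -> 0 <= a2 -> 0 <= b2 ->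
  a <= h * a1 + h * a2 -> b <= h * b1 + h * b2 ->
  a + b <= h * (a1 + b1) + h * (a2 + b2).
Proof.
by move=> *; rewrite !ge0_muleDr// addeACA leeD.
Qed.

Context (m n : nat) (lam : {sigma_finite_measure set T -> \bar R}).
Variables (g : 'rV[R]_(m * n) -> R) (K : R).
Hypothesis g_ge0 : forall x, (0 <= g x)%R.
Hypothesis g_convex : convex_function setT g.
Hypothesis K0 : (0 <= K)%R.
Hypothesis g_le : forall x, (g x <= K * (1 + l1norm x))%R.
Implicit Types mu : 'I_m * 'I_n -> {charge set T -> \bar R}.

Let g_lip := convex_growth_lipschitz_norm g_convex K0 g_le.
Let gi_lip := recession_lipschitz g_convex K0 g_le.
Let gi_ge0 x : (0 <= recession g x)%R.
Proof. exact: (recession_ge0 g_convex K0 g_le). Qed.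
Let gi_homog r x : (0 <= r)%R -> recession g (r *: x) = (r * recession g x)%R.
Proof. exact: (recessionZ g_convex K0 g_le). Qed.

Lemma convex_of_measureE mu (D : set T) : convex_of_measure lam g mu D =
  \int[lam]_(x in D) (g (vec_of (fun k => density (ac_part mu lam k) lam x)))%:E +
  \int[tv (singular_part mu lam)]_(x in D)
    (recession g (vec_of (fun k => density (singular_part mu lam k)
       (tv (singular_part mu lam)) x)))%:E.
Proof. by []. Qed.

Lemma convex_of_measure_ge0 mu D : 0 <= convex_of_measure lam g mu D.
Proof.
by rewrite convex_of_measureE adde_ge0// integral_ge0// => x _; rewrite lee_fin.
Qed.

Lemma convex_of_measure_lty mu D : measurable D -> lam D < +oo ->
  convex_of_measure lam g mu D < +oo.
Proof.
move=> mD lamD; rewrite convex_of_measureE lte_add_pinfty//.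
  apply: integrable_lty => //.
  exact: (integrable_density_comp g_ge0 g_lip mD lamD (@ac_part_dominates _ _ _ _ lam mu)).
apply: integrable_lty => //.
apply: (integrable_density_comp gi_ge0 gi_lip mD _ (@dominates_tv _ _ _ _ _)).
by rewrite ltey_eq fin_num_measure.
Qed.

(** The absolutely continuous densities average, so that part is convexity of
    [g]. For the singular part, the polar densities do not average, but the
    densities with respect to a common dominating measure do. *)
Lemma convex_of_measure_midpoint mu mu1 mu2 D : measurable D ->
  (forall k, charge_midpoint (mu k) (mu1 k) (mu2 k)) ->
  convex_of_measure lam g mu D <=
  2^-1%:E * convex_of_measure lam g mu1 D + 2^-1%:E * convex_of_measure lam g mu2 D.
Proof.
move=> mD muE; rewrite !convex_of_measureE.
have g0 (f : T -> 'rV[R]_(m * n)) : 0 <= \int[lam]_(x in D) (g (f x))%:E.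
  by apply: integral_ge0 => x _; rewrite lee_fin.
have gi0 (nu : {measure set T -> \bar R}) (f : T -> 'rV[R]_(m * n)) :
    0 <= \int[nu]_(x in D) (recession g (f x))%:E.
  by apply: integral_ge0 => x _; rewrite lee_fin.
apply: lee_midpointD (g0 _) (gi0 _ _) (g0 _) (gi0 _ _) _ _.
  have mden (m' : 'I_m * 'I_n -> {charge set T -> \bar R}) : measurable_fun D
      (fun x => g (vec_of (fun k => density (ac_part m' lam k) lam x))).
    apply: measurable_funTS; apply: (measurable_density_comp g_lip) => k.
    exact: ac_part_dominates.
  apply: (ge0_integral_le_midpoint mD _ _ _ (mden mu) (mden mu1) (mden mu2));
    [by move=> x; exact: g_ge0..|].
  have : {ae lam, forall x, forall k, density (ac_part mu lam k) lam x =
      (2^-1 * density (ac_part mu1 lam k) lam x +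
       2^-1 * density (ac_part mu2 lam k) lam x)%R}.
    apply: filter_forall => k; apply: density_midpoint.
    - exact: ac_part_dominates.
    - exact: ac_part_dominates.
    - exact: ac_part_dominates.
    - exact: ac_part_midpoint.
  apply: filterS => x /vec_of_midpoint ->.
  exact: convex_midpoint.
set s := singular_part mu lam; set s1 := singular_part mu1 lam.
set s2 := singular_part mu2 lam.
have sE k : charge_midpoint (s k) (s1 k) (s2 k) by exact: singular_part_midpoint.
(* the total variation of the joint family s1, s2 dominates s1, s2 and s *)
pose s12 (k : ('I_m * 'I_n) + ('I_m * 'I_n)) :=
  match k with inl i => s1 i | inr i => s2 i end.
pose tau := tv s12.
have s1tau k : s1 k `<< tau := @dominates_tv _ _ _ _ s12 (inl k).
have s2tau k : s2 k `<< tau := @dominates_tv _ _ _ _ s12 (inr k).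
have stau k : s k `<< tau.
  apply/null_content_dominatesP => A mA A0.
  have /null_content_dominatesP H1 := s1tau k.
  have /null_content_dominatesP H2 := s2tau k.
  by rewrite sE// H1// H2// !mule0 adde0.
have polarE (s' : 'I_m * 'I_n -> {charge set T -> \bar R}) :=
  @integral_polar_density _ _ _ _ _ _ _ gi_ge0 gi_lip gi_homog s' (tv s12) D mD.
rewrite (polarE s (tv_dominates stau)) (polarE s1 (tv_dominates s1tau)).
rewrite (polarE s2 (tv_dominates s2tau)).
have mden (m' : 'I_m * 'I_n -> {charge set T -> \bar R}) :
    (forall k, m' k `<< tau) -> measurable_fun D
    (fun x => recession g (vec_of (fun k => density (m' k) (tv s12) x))).
  move=> m'tau; apply: measurable_funTS.
  exact: (measurable_density_comp gi_lip).
apply: (ge0_integral_le_midpoint mD _ _ _ (mden _ stau) (mden _ s1tau) (mden _ s2tau));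
  [by move=> x; exact: gi_ge0..|].
have : {ae tv s12, forall x, forall k, density (s k) (tv s12) x =
    (2^-1 * density (s1 k) (tv s12) x + 2^-1 * density (s2 k) (tv s12) x)%R}.
  apply: filter_forall => k.
  exact: (density_midpoint (stau k) (s1tau k) (s2tau k) (sE k)).
apply: filterS => x /vec_of_midpoint ->.
exact: (recession_midpoint g_convex K0 g_le).
Qed.

End convex_of_measure.

(** * Integration against charges and test functions *)

Section charge_integral.
Local Open Scope ereal_scope.
Context d (T : measurableType d) (R : realType).
Implicit Types (nu : {charge set T -> \bar R}) (phi : T -> R).

Lemma bounded_integrable (mu : {measure set T -> \bar R}) phi M :
  mu setT < +oo -> measurable_fun setT phi -> (forall x, `|phi x| <= M)%R ->
  mu.-integrable setT (EFin \o phi).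
Proof.
move=> muT mphi phiM; apply: measurable_bounded_integrable => //.
exists M; split; first exact: num_real.
by move=> N MN x _ /=; rewrite (le_trans (phiM x))// ltW.
Qed.

Lemma jordan_decompE nu P N (H : hahn_decomposition nu P N) A : measurable A ->
  nu A = (fine (jordan_pos H A) - fine (jordan_neg H A))%:E.
Proof.
have finE (m : {finite_measure set T -> \bar R}) : measurable A ->
  (fine (m A))%:E = m A by move=> mA; rewrite fineK// fin_num_measure.
move=> mA; rewrite EFinB (finE (jordan_pos H))// (finE (jordan_neg H))//.
by rewrite [LHS](jordan_decomp H mA) /cadd/= cscaleN1.
Qed.

(** The Jordan parts of [nu] are not the averages of those of [nu1] and [nu2].
    Moving all the negative parts to the other side leaves an equality between
    two sums of finite measures, against which integration is additive. *)
Lemma charge_integral_midpoint nu nu1 nu2 phi M :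
  measurable_fun setT phi -> (forall x, `|phi x| <= M)%R ->
  charge_midpoint nu nu1 nu2 ->
  charge_integral nu (EFin \o phi) = 2^-1%:E * charge_integral nu1 (EFin \o phi) +
    2^-1%:E * charge_integral nu2 (EFin \o phi).
Proof.
move=> mphi phiM nuE; rewrite /charge_integral.
move: (svalP (cid (svalP (cid (Hahn_decomposition nu))))) => H.
move: (svalP (cid (svalP (cid (Hahn_decomposition nu1))))) => H1.
move: (svalP (cid (svalP (cid (Hahn_decomposition nu2))))) => H2.
set p := jordan_pos H; set n := jordan_neg H.
set p1 := jordan_pos H1; set n1 := jordan_neg H1.
set p2 := jordan_pos H2; set n2 := jordan_neg H2.
(* both sides are doubled to avoid the scalars *)
pose ml := measure_add p (measure_add p (measure_add n1 n2)).
pose mr := measure_add n (measure_add n (measure_add p1 p2)).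
have fT (m : {finite_measure set T -> \bar R}) : m setT < +oo.
  by rewrite ltey_eq fin_num_measure.
have lrE A : measurable A -> ml A = mr A.
  move=> mA; have := nuE A mA.
  rewrite (jordan_decompE H mA) (jordan_decompE H1 mA) (jordan_decompE H2 mA).
  rewrite -!EFinM -!EFinD => -[E].
  have addE (m1 m2 m3 m4 : {finite_measure set T -> \bar R}) :
      measure_add m1 (measure_add m2 (measure_add m3 m4)) A =
      (fine (m1 A) + (fine (m2 A) + (fine (m3 A) + fine (m4 A))))%:E.
    rewrite measure_addE !EFinD !fineK ?fin_num_measure//; congr (_ + _).
    apply: etrans (measure_addE _ _ _) _; congr (_ + _).
    exact: measure_addE.
  by rewrite /ml /mr (addE p p n1 n2) (addE n n p1 p2); congr EFin; lra.
have iphi (m : {measure set T -> \bar R}) : m setT < +oo -> m.-integrable setT (EFin \o phi).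
  by move=> mT; apply: bounded_integrable mphi phiM.
have : \int[ml]_x (EFin \o phi) x = \int[mr]_x (EFin \o phi) x.
  by apply: eq_measure_integral => A mA _; exact: lrE.
have ip := iphi p (fT p); have inn := iphi n (fT n).
have ip1 := iphi p1 (fT p1); have in1 := iphi n1 (fT n1).
have ip2 := iphi p2 (fT p2); have in2 := iphi n2 (fT n2).
have aT (m1 m2 : {measure set T -> \bar R}) : m1 setT < +oo -> m2 setT < +oo ->
    measure_add m1 m2 setT < +oo.
  by move=> m1T m2T; rewrite measure_addE lte_add_pinfty.
have i12 := iphi _ (aT _ _ (fT n1) (fT n2)).
have j12 := iphi _ (aT _ _ (fT p1) (fT p2)).
have ipn := iphi _ (aT _ _ (fT p) (aT _ _ (fT n1) (fT n2))).
have inp := iphi _ (aT _ _ (fT n) (aT _ _ (fT p1) (fT p2))).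
have mE : measurable_fun setT (EFin \o phi) by exact/measurable_EFinP.
rewrite !integral_measure_add//.
have finI (m : {measure set T -> \bar R}) : m.-integrable setT (EFin \o phi) ->
    \int[m]_x (EFin \o phi) x = (fine (\int[m]_x (EFin \o phi) x))%:E.
  by move=> im; rewrite fineK// integrable_fin_num.
rewrite (finI p ip) (finI n inn) (finI p1 ip1) (finI n1 in1) (finI p2 ip2) (finI n2 in2).
by rewrite -!EFinN -!EFinD => -[E]; congr EFin; lra.
Qed.

Lemma charge_integral_fin_num nu phi M :
  measurable_fun setT phi -> (forall x, `|phi x| <= M)%R ->
  charge_integral nu (EFin \o phi) \is a fin_num.
Proof.
move=> mphi phiM; rewrite /charge_integral.
rewrite fin_numB !integrable_fin_num//; apply: bounded_integrable mphi phiM.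
  by rewrite ltey_eq fin_num_measure.
by rewrite ltey_eq fin_num_measure.
Qed.

Lemma charge_integral0 nu phi : (forall A, measurable A -> nu A = 0) ->
  charge_integral nu (EFin \o phi) = 0.
Proof.
move=> nu0; rewrite /charge_integral.
move: (svalP (cid (svalP (cid (Hahn_decomposition nu))))) => H.
have [[mP _] [mN _] _ _] := H.
rewrite (@eq_measure_integral _ _ _ _ mzero); last first.
  move=> A mA _; apply: etrans (jordan_posE H A) _.
  rewrite cjordan_posE /crestr0/= mem_set// /crestr nu0//.
  exact: measurableI.
rewrite (@eq_measure_integral _ _ _ _ mzero (jordan_neg H)); last first.
  move=> A mA _; apply: etrans (jordan_negE H A) _.
  rewrite cjordan_negE /crestr0/= mem_set// /crestr nu0 ?oppe0//.
  exact: measurableI.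
by rewrite integral_measure_zero sube0.
Qed.

End charge_integral.

Section test_functions.
Context {R : realType}.
Implicit Types (phi : R * R -> R) (Omega : set (R * R)).

Lemma continuous_measurable_plane phi : continuous phi ->
  measurable_fun setT (phi : plane R -> R).
Proof.
move=> cphi.
apply: (measurability _ (RGenOInfty.measurableE R)) => /= _ [_ [a ->] <-].
rewrite setTI; apply: open_measurable_plane.
by apply: open_comp; [by move=> x _; exact: cphi|rewrite set_itvoy; exact: open_gt].
Qed.

Lemma test_function_continuous Omega phi : test_function Omega phi -> continuous phi.
Proof. by move=> [/(_ 0%N) []]. Qed.

Lemma test_function_bounded Omega phi : test_function Omega phi ->
  exists M, forall x, `|phi x| <= M.
Proof.
move=> tphi; have cphi := test_function_continuous tphi.
have [_ [K [cK _ phi0]]] := tphi.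
have /compact_bounded[M [_ HM]] : compact (phi @` K).
  by apply: continuous_compact => //; exact: continuous_subspaceT.
exists (`|M| + 1) => x.
have [Kx|nKx] := pselect (K x).
  by apply: HM; [rewrite ltr_pwDr// ler_norm|exists x].
by rewrite phi0// normr0 addr_ge0.
Qed.

Lemma test_function_partial Omega phi i :
  test_function Omega phi -> test_function Omega (partial i phi).
Proof.
move=> [Cphi [K [cK KO phi0]]]; split.
  by move=> n; have [_ /(_ i)[]] := Cphi n.+1.
exists K; split => // x nKx.
have cK' : closed K by apply: compact_closed => //; exact: norm_hausdorff.
have nbx : \forall y \near x, ~ K y.
  exact: (open_nbhs_nbhs (conj (closed_openC cK') nKx)).
rewrite /partial.
have -> : 'D_(basis_vec i) phi x = 'D_(basis_vec i) (cst 0) x.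
  by apply: near_eq_derive; apply: filterS nbx => y; exact: phi0.
exact: derive_cst.
Qed.

Lemma test_function_measurable Omega phi : test_function Omega phi ->
  measurable_fun setT (phi : plane R -> R).
Proof. by move/test_function_continuous; exact: continuous_measurable_plane. Qed.

Lemma integrableM_test (mu : {measure set (plane R) -> \bar R}) Omega phi
    (u : plane R -> R) : test_function Omega phi ->
  mu.-integrable setT (EFin \o u) ->
  mu.-integrable setT (fun x => (u x * phi x)%:E).
Proof.
move=> tphi iu; have [M HM] := test_function_bounded tphi.
under eq_fun do rewrite mulrC EFinM.
apply: integrableMr => //; first exact: test_function_measurable tphi.
exists M; split; first exact: num_real.
by move=> N MN x _ /=; rewrite (le_trans (HM x))// ltW.
Qed.

End test_functions.

(** * The space BH is closed under averages *)

Lemma integral_midpoint d (T : measurableType d) (R : realType)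
    (mu : {measure set T -> \bar R}) (F1 F2 : T -> R) :
  mu.-integrable setT (EFin \o F1) -> mu.-integrable setT (EFin \o F2) ->
  (\int[mu]_x (2^-1 * F1 x + 2^-1 * F2 x)%:E =
   2^-1%:E * \int[mu]_x (F1 x)%:E + 2^-1%:E * \int[mu]_x (F2 x)%:E)%E.
Proof.
move=> i1 i2; under eq_integral do rewrite EFinD 2!EFinM.
by rewrite integralD// ?integralZl//; exact: integrableZl.
Qed.

Lemma integrable_midpoint d (T : measurableType d) (R : realType)
    (mu : {measure set T -> \bar R}) (F1 F2 : T -> R) :
  mu.-integrable setT (EFin \o F1) -> mu.-integrable setT (EFin \o F2) ->
  mu.-integrable setT (fun x => (2^-1 * F1 x + 2^-1 * F2 x)%:E).
Proof.
move=> i1 i2; under eq_fun do rewrite EFinD 2!EFinM.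
by apply: integrableD => //; exact: integrableZl.
Qed.

Section BH_space.
Local Open Scope ereal_scope.
Context {R : realType} {Omega : set (R * R)} {oOmega : open Omega}.
Implicit Types u v w : BH oOmega.
Notation leb := (leb_on oOmega).

Lemma BH_fun_integrable u : leb.-integrable setT (EFin \o u).
Proof. exact/Lfun1_integrable/BH_fun_L1. Qed.

Lemma BH_grad_integrable u i : leb.-integrable setT (fun x => (BH_grad u x 0%R i)%:E).
Proof. exact/Lfun1_integrable/BH_grad_L1. Qed.

Lemma measurable_BH_grad u i : measurable_fun setT
  ((fun x => BH_grad u x 0%R i) : plane R -> R).
Proof. by apply/measurable_EFinP; exact: measurable_int (BH_grad_integrable u i). Qed.

Lemma BH_midpoint u v : exists w,
  [/\ (w : R * R -> R) = (fun x => 2^-1 * u x + 2^-1 * v x)%R,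
      BH_grad w = (fun x => 2^-1 *: BH_grad u x + 2^-1 *: BH_grad v x)%R &
      forall k, charge_midpoint (BH_hess w k) (BH_hess u k) (BH_hess v k)].
Proof.
pose wf (x : R * R) := (2^-1 * u x + 2^-1 * v x)%R.
pose wg (x : R * R) := (2^-1 *: BH_grad u x + 2^-1 *: BH_grad v x)%R.
pose wh k : {charge set (plane R) -> \bar R} :=
  cadd (cscale 2^-1 (BH_hess u k)) (cscale 2^-1 (BH_hess v k)).
have whE k : charge_midpoint (wh k) (BH_hess u k) (BH_hess v k) by [].
have wgE x i : wg x 0%R i = (2^-1 * BH_grad u x 0 i + 2^-1 * BH_grad v x 0 i)%R.
  by rewrite !mxE.
have wf1 : (wf : plane R -> R) \in Lfun leb 1.
  by apply/Lfun1_integrable; apply: integrable_midpoint; exact: BH_fun_integrable.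
have wg1 i : ((fun x => wg x 0%R i) : plane R -> R) \in Lfun leb 1.
  apply/Lfun1_integrable; rewrite [EFin \o _](_ : _ = (fun x =>
      (2^-1 * BH_grad u x 0 i + 2^-1 * BH_grad v x 0 i)%:E)%R); last first.
    by apply/funext => x; rewrite /= wgE.
  by apply: integrable_midpoint; exact: BH_grad_integrable.
have wgrad i phi : test_function Omega phi ->
    \int[leb]_x (wf x * partial i phi x)%:E = - \int[leb]_x (wg x 0%R i * phi x)%:E.
  move=> tphi; have tpphi := test_function_partial i tphi.
  transitivity (\int[leb]_x (2^-1 * (u x * partial i phi x) +
      2^-1 * (v x * partial i phi x))%:E).
    by apply: eq_integral => x _; congr EFin; rewrite /wf; ring.
  rewrite integral_midpoint; last 2 first.
  - exact: integrableM_test tpphi (BH_fun_integrable u).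
  - exact: integrableM_test tpphi (BH_fun_integrable v).
  rewrite !BH_weak_grad//.
  transitivity (- \int[leb]_x (2^-1 * (BH_grad u x 0 i * phi x) +
      2^-1 * (BH_grad v x 0 i * phi x))%:E); last first.
    by congr (- _); apply: eq_integral => x _; congr EFin; rewrite wgE; ring.
  have iu := integrableM_test tphi (BH_grad_integrable u i).
  have iv := integrableM_test tphi (BH_grad_integrable v i).
  rewrite integral_midpoint//.
  rewrite !muleN oppeD//.
  by rewrite fin_num_adde_defr// fin_numM// integrable_fin_num.
have whon i j A : measurable A -> wh (i, j) A = wh (i, j) (A `&` Omega).
  move=> mA; rewrite !whE//; last by apply: measurableI => //; exact: open_measurable_plane.
  by rewrite (BH_hess_on u)// (BH_hess_on v).
have whess i j phi : test_function Omega phi ->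
    \int[leb]_x (wg x 0%R i * partial j phi x)%:E =
    - charge_integral (wh (i, j)) (EFin \o phi).
  move=> tphi; have tpphi := test_function_partial j tphi.
  transitivity (\int[leb]_x (2^-1 * (BH_grad u x 0 i * partial j phi x) +
      2^-1 * (BH_grad v x 0 i * partial j phi x))%:E).
    by apply: eq_integral => x _; congr EFin; rewrite wgE; ring.
  rewrite integral_midpoint; last 2 first.
  - exact: integrableM_test tpphi (BH_grad_integrable u i).
  - exact: integrableM_test tpphi (BH_grad_integrable v i).
  rewrite !BH_weak_hess//.
  have [M HM] := test_function_bounded tphi.
  have mphi := test_function_measurable tphi.
  rewrite (charge_integral_midpoint mphi HM (whE (i, j))).
  rewrite !muleN oppeD//.
  by rewrite fin_num_adde_defr// fin_numM// (charge_integral_fin_num _ mphi HM).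
by exists (Build_BH wf1 wg1 wgrad whon whess).
Qed.

Lemma BH_zero : exists w, (w : R * R -> R) = cst 0%R.
Proof.
pose wh (k : 'I_2 * 'I_2) : {charge set (plane R) -> \bar R} := czero.
have wf1 : ((cst 0%R : R * R -> R) : plane R -> R) \in Lfun leb 1.
  by apply/Lfun1_integrable; exact: integrable0.
have wg1 i : ((fun x => (cst 0 : R * R -> 'rV[R]_2) x 0 i)%R : plane R -> R)
    \in Lfun leb 1.
  apply/Lfun1_integrable; rewrite [EFin \o _](_ : _ = cst 0); first exact: integrable0.
  by apply/funext => x; rewrite /= mxE.
have wgrad i phi : test_function Omega phi ->
    \int[leb]_x ((cst 0%R : R * R -> R) x * partial i phi x)%:E =
    - \int[leb]_x ((cst 0%R : R * R -> 'rV[R]_2) x 0%R i * phi x)%:E.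
  move=> _; rewrite !integral0_eq ?oppe0// => x _; first by rewrite mxE mul0r.
  by rewrite mul0r.
have whon i j A : measurable A -> wh (i, j) A = wh (i, j) (A `&` Omega) by [].
have whess i j phi : test_function Omega phi ->
    \int[leb]_x ((cst 0%R : R * R -> 'rV[R]_2) x 0%R i * partial j phi x)%:E =
    - charge_integral (wh (i, j)) (EFin \o phi).
  move=> _; rewrite charge_integral0// oppe0 integral0_eq// => x _.
  by rewrite mxE mul0r.
by exists (Build_BH wf1 wg1 wgrad whon whess).
Qed.

End BH_space.

(** * Smooth functions of one variable *)

Section smooth_functions.
Context {R : realType}.
Implicit Types f g : R -> R.

(** The derivative is an explicit witness, so that closure under products and
    compositions is the product rule and the chain rule, by induction. *)
Fixpoint Ck (n : nat) f : Prop :=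
  if n is m.+1 then
    exists2 f', (forall x : R, is_derive x 1 f (f' x)) & Ck m f'
  else True.

Definition smooth f := forall n, Ck n f.

Lemma CkW n f : Ck n.+1 f -> Ck n f.
Proof.
elim: n f => [//|n ih] f [f' ff' Cf']; exists f' => //; exact: ih.
Qed.

Lemma smooth_derive f : smooth f ->
  exists2 f', (forall x : R, is_derive x 1 f (f' x)) & smooth f'.
Proof.
move=> sf; have [f' ff' _] := sf 1; exists f' => // n.
have [f'' ff'' Cf''] := sf n.+1.
suff -> : f' = f'' by [].
by apply/funext => x; rewrite -(@derive_val _ _ _ _ _ _ _ (ff' x)) derive_val.
Qed.

Lemma CkD n f g : Ck n f -> Ck n g -> Ck n (fun x => f x + g x).
Proof.
elim: n f g => [//|n ih] f g [f' ff' Cf'] [g' gg' Cg'].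
exists (fun x => f' x + g' x); last exact: ih.
by move=> x; exact: is_deriveD.
Qed.

Lemma CkM n f g : Ck n f -> Ck n g -> Ck n (fun x => f x * g x).
Proof.
elim: n f g => [//|n ih] f g Cf Cg.
have [f' ff' Cf'] := Cf; have [g' gg' Cg'] := Cg.
exists (fun x => f x * g' x + g x * f' x).
  by move=> x; exact: is_deriveM.
by apply: CkD; apply: ih => //; exact: CkW.
Qed.

Lemma Ck_comp n f g : Ck n f -> Ck n g -> Ck n (f \o g).
Proof.
elim: n f g => [//|n ih] f g [f' ff' Cf'] Cg.
have [g' gg' Cg'] := Cg.
exists (fun x => f' (g x) * g' x).
  by move=> x; exact: is_derive1_comp.
by apply: CkM => //; apply: (ih f') => //; exact: CkW.
Qed.

Lemma smooth_cst (c : R) : smooth (cst c).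
Proof.
move=> n; elim: n c => [//|n ih] c; exists (cst 0); last exact: ih.
by move=> x; exact: is_derive_cst.
Qed.

Lemma smooth_id : smooth id.
Proof. by case=> [//|n]; exists (cst 1); [move=> x; exact: is_derive_id|exact: smooth_cst]. Qed.

Lemma smoothD f g : smooth f -> smooth g -> smooth (fun x => f x + g x).
Proof. by move=> sf sg n; exact: CkD. Qed.

Lemma smoothM f g : smooth f -> smooth g -> smooth (fun x => f x * g x).
Proof. by move=> sf sg n; exact: CkM. Qed.

Lemma smooth_comp f g : smooth f -> smooth g -> smooth (f \o g).
Proof. by move=> sf sg n; exact: Ck_comp. Qed.

Lemma smooth_affine (a b : R) : smooth (fun x => a * x + b).
Proof.
exact: smoothD (smoothM (smooth_cst a) smooth_id) (smooth_cst b).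
Qed.

Lemma smooth_continuous f : smooth f -> continuous f.
Proof.
move=> /smooth_derive[f' ff' _] x; apply/differentiable_continuous.
by apply/derivable1_diffP; have [] := ff' x.
Qed.

(** The functions [p(1/t) * exp(-1/t)] form a family which is stable under
    differentiation; this makes [exp(-1/t)] smooth at 0. *)
Definition flat (p : {poly R}) (t : R) : R :=
  if 0 < t then p.[t^-1] * expR (- t^-1) else 0.

Lemma horner_norm_le (p : {poly R}) : exists2 M : R, 0 <= M &
  forall s, 1 <= s -> `|p.[s]| <= M * s ^+ (size p).
Proof.
exists (\sum_(i < size p) `|p`_i|); first exact: sumr_ge0.
move=> s s1; rewrite horner_coef mulr_suml (le_trans (ler_norm_sum _ _ _))//.
apply: ler_sum => i _; have s0 : 0 <= s by rewrite (le_trans _ s1).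
rewrite normrM normrX (ger0_norm s0) ler_wpM2l//.
by rewrite ler_weXn2l// ltnW.
Qed.

(** With [s = 1/t], the bound [s ^ (n + 2) / (n + 2)! <= exp s] beats the
    growth [s ^ n] of the polynomial by the factor [t ^ 2], which makes the
    derivative at 0 vanish. *)
Lemma flat_le (p : {poly R}) : exists2 C : R, 0 <= C &
  forall t, 0 < t <= 1 -> `|flat p t| <= C * t ^+ 2.
Proof.
have [M M0 HM] := horner_norm_le p.
exists (M * (size p).+2`!%:R); first exact: mulr_ge0.
move=> t /andP[t0 t1]; rewrite /flat t0 normrM.
set s := t^-1; have s1 : 1 <= s by rewrite invf_ge1.
have s0 : 0 < s by rewrite invr_gt0.
rewrite (ger0_norm (expR_ge0 _)) expRN ler_pdivrMr ?expR_gt0//.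
rewrite (le_trans (HM _ s1))// -mulrA -mulrA ler_wpM2l//.
have -> : t ^+ 2 = s ^- 2 by rewrite /s exprVn invrK.
have : s ^+ (size p).+2 / (size p).+2`!%:R <= expR s.
  by apply: le_trans (expR_ge1Dxn (size p).+1 (ltW s0)); rewrite ?lerDr.
rewrite ler_pdivrMr ?ltr0n ?fact_gt0// => h.
by rewrite mulrAC ler_pdivlMr ?exprn_gt0// -exprD addn2 [leRHS]mulrC.
Qed.

Lemma is_derive_flat (p : {poly R}) (t : R) :
  is_derive t 1 (flat p) (flat ('X ^+ 2 * (p - p^`())) t).
Proof.
have [t0|t0|->] := ltgtP t 0.
- have near0 : \forall s \near t, flat p s = cst 0 s.
    near=> s; rewrite /flat ifF//; apply/negbTE; rewrite -leNgt ltW//.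
    near: s; exact: lt_nbhsl.
  have -> : flat ('X ^+ 2 * (p - p^`())) t = 0 by rewrite /flat ltNge ltW.
  apply: (near_eq_is_derive _ (is_derive_cst (0 : R) t 1)).
  by apply: filterS near0.
- pose F (s : R) : R := p.[s^-1] * expR (- s^-1).
  have nearF : \forall s \near t, F s = flat p s.
    near=> s; rewrite /flat ifT//; near: s; exact: lt_nbhsr.
  have tn0 : t != 0 by rewrite gt_eqF.
  have dV : is_derive t 1 (fun s : R => s^-1) (- t ^- 2).
    have := @is_deriveV _ id t 1 1 tn0 (is_derive_id _ _).
    by rewrite /GRing.scale/= mulr1.
  have : is_derive t 1 F (flat ('X ^+ 2 * (p - p^`())) t).
    have dp := is_derive1_comp (is_derive_poly p t^-1) dV.
    have dN : is_derive t 1 (fun s : R => - s^-1) (t ^- 2).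
      by rewrite -[t ^- 2]opprK; exact: is_deriveN dV.
    have de := @is_derive1_comp _ expR (fun s => - s^-1) t _ _ (is_derive_expR _) dN.
    have := is_deriveM dp de.
    rewrite [X in is_derive _ _ _ X](_ : _ = flat ('X ^+ 2 * (p - p^`())) t)//.
    rewrite /flat t0 /= !hornerE /GRing.scale/=.
    by rewrite exprVn; ring.
  by move=> dF; apply: near_eq_is_derive dF; apply: filterS nearF => s ->.
- have -> : flat ('X ^+ 2 * (p - p^`())) 0 = 0 by rewrite /flat ltxx.
  have [C C0 HC] := flat_le p.
  have C1 : 0 < C + 1 by rewrite ltr_wpDl.
  have cv : h^-1 *: (flat p (h *: 1 + 0) - flat p 0) @[h --> 0^'] --> (0 : R).
    apply/cvgr0Pnorm_le => e e0; near=> h.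
    have h0 : h != 0 by near: h; exact: nbhs_dnbhs_neq.
    rewrite {2}/flat ltxx subr0 addr0 /GRing.scale/= mulr1.
    have [hneg|hpos] := leP h 0; first by rewrite /flat ltNge hneg/= mulr0 normr0 ltW.
    have h1 : h <= 1.
      rewrite (le_trans (ler_norm _))//; near: h; apply: dnbhs0_le; exact: ltr01.
    rewrite normrM (gtr0_norm (_ : 0 < h^-1)) ?invr_gt0// ler_pdivrMl//.
    rewrite (le_trans (HC _ _)) ?hpos// expr2 mulrCA ler_pM2l//.
    have : h <= e / (C + 1).
      rewrite (le_trans (ler_norm _))//; near: h; apply: dnbhs0_le.
      exact: divr_gt0.
    by rewrite ler_pdivlMr// mulrDr mulr1; lra.
  by apply: DeriveDef; [exact: (cvgP _ cv)|exact: cvg_lim cv].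
Unshelve. all: end_near. Qed.

Lemma smooth_flat (p : {poly R}) : smooth (flat p).
Proof.
move=> n; elim: n p => [//|n ih] p; exists (flat ('X ^+ 2 * (p - p^`()))) => //.
by move=> x; exact: is_derive_flat.
Qed.

Definition bump (t : R) : R := flat 1%:P t.

Lemma bumpE t : bump t = if 0 < t then expR (- t^-1) else 0.
Proof. by rewrite /bump /flat hornerC mul1r. Qed.

Lemma bump_le0 t : t <= 0 -> bump t = 0.
Proof. by rewrite bumpE ltNge => ->. Qed.

Lemma bump1_gt0 : 0 < bump 1.
Proof. by rewrite bumpE ltr01 expR_gt0. Qed.

Lemma bump_ge1 t : 1 <= t -> bump 1 <= bump t.
Proof.
move=> t1; have t0 : 0 < t by exact: lt_le_trans t1.
by rewrite !bumpE ltr01 t0 ler_expR lerN2 lef_pV2 ?posrE.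
Qed.

(** For [t >= 1] the inner bump vanishes; for [t <= 0] it is at least [bump 1],
    so the argument of the outer bump is nonpositive. A composition is smooth
    with less work than the usual quotient. *)
Definition step (t : R) : R := (bump 1)^-1 * bump (1 - (bump 1)^-1 * bump (1 - t)).

Lemma smooth_step : smooth step.
Proof.
have sb : smooth bump by exact: smooth_flat.
have b1 : smooth (fun t : R => bump (1 - t)).
  apply: (smooth_comp sb); have := smooth_affine (-1) 1.
  by congr (smooth _); apply/funext => t; rewrite mulN1r addrC.
apply: (smoothM (smooth_cst (bump 1)^-1)); apply: (smooth_comp sb).
have := smoothD (smooth_cst 1) (smoothM (smooth_cst (- (bump 1)^-1)) b1).
by congr (smooth _); apply/funext => t; rewrite /= mulNr.
Qed.

Lemma step_le0 t : t <= 0 -> step t = 0.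
Proof.
move=> t0; rewrite /step (bump_le0 (t := 1 - _)) ?mulr0//.
rewrite subr_le0 mulrC ler_pdivlMr ?bump1_gt0// mul1r bump_ge1//.
by rewrite lerDl oppr_ge0.
Qed.

Lemma step_ge1 t : 1 <= t -> step t = 1.
Proof.
move=> t1; rewrite /step (bump_le0 (t := 1 - t)) ?subr_le0//.
by rewrite mulr0 subr0 mulVf// gt_eqF// bump1_gt0.
Qed.

Lemma continuous_step_bounded f : continuous f ->
  (forall t : R, t <= 0 -> f t = 0) -> (forall t : R, 1 < t -> f t = 1) ->
  exists M : R, forall t, `|f t| <= M.
Proof.
move=> cf f0 f1.
have /compact_bounded[M [_ HM]] : compact (f @` `[0, 1]).
  apply: continuous_compact; last exact: segment_compact.
  exact: continuous_subspaceT.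
exists (`|M| + 1) => t.
have [t0|t0] := leP t 0; first by rewrite f0// normr0 addr_ge0.
have [t1|t1] := ltP 1 t; first by rewrite f1// normr1 lerDr.
apply: HM; first by rewrite ltr_pwDr// ler_norm.
by exists t => //=; rewrite in_itv/= (ltW t0).
Qed.

(** The derivative [K] of the ramp [P t = t * step t] is a smoothed Heaviside
    function. It need not be monotone, but [P t = t] holds exactly for [t >= 1],
    so no integral has to be computed to know the primitive of [K]. *)
Lemma smooth_ramp_exists : exists P K : R -> R,
  [/\ smooth P, smooth K, forall x : R, is_derive x 1 P (K x),
      (forall t : R, t <= 0 -> P t = 0) /\ (forall t : R, 1 <= t -> P t = t) &
      [/\ forall t : R, t <= 0 -> K t = 0, forall t : R, 1 < t -> K t = 1 &
          exists M : R, forall t, `|K t| <= M]].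
Proof.
have [S sS S'] := smooth_derive smooth_step.
pose P t := t * step t; pose K t := t * S t + step t * 1.
have dP (x : R) : is_derive x 1 P (K x).
  exact: is_deriveM (is_derive_id x 1) (sS x).
have P0 t : t <= 0 -> P t = 0 by move=> t0; rewrite /P step_le0 ?mulr0.
have P1 t : 1 <= t -> P t = t by move=> t1; rewrite /P step_ge1 ?mulr1.
have sK : smooth K.
  apply: smoothD; first exact: smoothM smooth_id S'.
  exact: smoothM smooth_step (smooth_cst 1).
have K0 t : t <= 0 -> K t = 0.
  rewrite le_eqVlt => /predU1P[->|t0]; first by rewrite /K mul0r step_le0 ?mul0r ?addr0.
  have dc : is_derive t 1 P 0.
    apply: (near_eq_is_derive _ (is_derive_cst (0 : R) t 1)).
    by near=> s; rewrite P0// ltW//; near: s; exact: lt_nbhsl.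
  by rewrite -(@derive_val _ _ _ _ _ _ _ (dP t)) derive_val.
have K1 t : 1 < t -> K t = 1.
  move=> t1.
  have dc : is_derive t 1 P 1.
    apply: (near_eq_is_derive _ (is_derive_id t 1)).
    by near=> s; rewrite P1// ltW//; near: s; exact: lt_nbhsr.
  by rewrite -(@derive_val _ _ _ _ _ _ _ (dP t)) derive_val.
exists P, K; split => //.
- exact: smoothM smooth_id smooth_step.
- split => //; apply: continuous_step_bounded => //.
  exact: smooth_continuous.
Unshelve. all: end_near. Qed.

End smooth_functions.

(** * Product test functions *)

Section tensor_test_functions.
Context {R : realType}.
Implicit Types (A B : R -> R) (z : R * R).

Definition tensor A B (z : R * R) : R := A z.1 * B z.2.

Lemma is_derive_tensor1 A A' B z : (forall x : R, is_derive x 1 A (A' x)) ->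
  is_derive z (1, 0) (tensor A B) (tensor A' B z).
Proof.
move=> dA; have [/cvg_ex[l Al] A'E] := dA z.1.
have lE : l = A' z.1 by rewrite -A'E; apply/esym/cvg_lim.
have cv : h^-1 *: ((tensor A B \o shift z) (h *: (1, 0)) - tensor A B z)
    @[h --> 0^'] --> tensor A' B z.
  rewrite /tensor -lE; move: Al => /(@cvgMr_tmp _ _ _ _ _ _ (B z.2)).
  apply: cvg_trans; apply: near_eq_cvg; apply: nearW => h /=.
  by rewrite /GRing.scale/= mulr0 add0r -mulrBl mulrA.
by apply: DeriveDef; [exact: (cvgP _ cv)|exact: cvg_lim cv].
Qed.

Lemma is_derive_tensor2 A B B' z : (forall x : R, is_derive x 1 B (B' x)) ->
  is_derive z (0, 1) (tensor A B) (tensor A B' z).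
Proof.
move=> dB; have [/cvg_ex[l Bl] B'E] := dB z.2.
have lE : l = B' z.2 by rewrite -B'E; apply/esym/cvg_lim.
have cv : h^-1 *: ((tensor A B \o shift z) (h *: (0, 1)) - tensor A B z)
    @[h --> 0^'] --> tensor A B' z.
  rewrite /tensor -lE; move: Bl => /(@cvgMl_tmp _ _ _ _ _ (A z.1)).
  apply: cvg_trans; apply: near_eq_cvg; apply: nearW => h /=.
  by rewrite /GRing.scale/= mulr0 add0r -mulrBr mulrCA.
by apply: DeriveDef; [exact: (cvgP _ cv)|exact: cvg_lim cv].
Qed.

Lemma partial_tensor1 A A' B : (forall x : R, is_derive x 1 A (A' x)) ->
  partial ord0 (tensor A B) = tensor A' B.
Proof.
move=> dA; apply/funext => z; rewrite /partial /basis_vec eqxx.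
by have := @derive_val _ _ _ _ _ _ _ (is_derive_tensor1 B z dA).
Qed.

Lemma partial_tensor2 A B B' : (forall x : R, is_derive x 1 B (B' x)) ->
  partial ord_max (tensor A B) = tensor A B'.
Proof.
move=> dB; apply/funext => z; rewrite /partial /basis_vec/=.
by have := @derive_val _ _ _ _ _ _ _ (is_derive_tensor2 A z dB).
Qed.

Lemma continuous_tensor A B : continuous A -> continuous B -> continuous (tensor A B).
Proof.
move=> cA cB z; apply: cvgM.
  by apply: (cvg_comp _ _ cvg_fst); exact: cA.
by apply: (cvg_comp _ _ cvg_snd); exact: cB.
Qed.

Lemma Cn_tensor n A B : smooth A -> smooth B -> Cn n (tensor A B).
Proof.
elim: n A B => [|n ih] A B sA sB /=; (split;
  first by apply: continuous_tensor; exact: smooth_continuous) => //.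
have [A' dA sA'] := smooth_derive sA; have [B' dB sB'] := smooth_derive sB.
move=> i; have [->|i0] := eqVneq i ord0.
  rewrite (partial_tensor1 B dA); split; last exact: ih.
  by move=> z; rewrite /basis_vec eqxx; have [] := is_derive_tensor1 B z dA.
have -> : i = ord_max by apply/val_inj; move: i0; case: i => -[|[|]].
rewrite (partial_tensor2 A dB); split; last exact: ih.
by move=> z; rewrite /basis_vec/=; have [] := is_derive_tensor2 A z dB.
Qed.

Lemma test_function_tensor (Omega : set (R * R)) A B (a1 a2 b1 b2 : R) :
  smooth A -> smooth B ->
  (forall x, ~~ (a1 <= x <= a2) -> A x = 0) ->
  (forall y, ~~ (b1 <= y <= b2) -> B y = 0) ->
  `[a1, a2] `*` `[b1, b2] `<=` Omega -> test_function Omega (tensor A B).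
Proof.
move=> sA sB A0 B0 KO; split; first by move=> n; exact: Cn_tensor.
exists (`[a1, a2] `*` `[b1, b2]); split => //.
  by apply: compact_setX; exact: segment_compact.
move=> [x y] /= nK; rewrite /tensor/=.
have [xa|xa] := boolP (a1 <= x <= a2); last by rewrite A0// mul0r.
have [yb|yb] := boolP (b1 <= y <= b2); last by rewrite B0// mulr0.
by exfalso; apply: nK; split; rewrite /= in_itv.
Qed.

End tensor_test_functions.

Section ramp_family.
Context {R : realType}.

Definition ind (p q x : R) : R := (p < x <= q)%R%:R.

Lemma ramp_diff_cvg (K : R -> R) (p q : R) (rho : R) (x : R) : p < q -> 0 < rho ->
  (forall t, t <= 0 -> K t = 0) -> (forall t, 1 < t -> K t = 1) ->
  (K ((n.+1%:R / rho) * (x - p)) - K ((n.+1%:R / rho) * (x - q))) @[n --> \oo] -->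
  ind p q x.
Proof.
move=> pq rho0 K0 K1.
have Kcvg (c : R) : K ((n.+1%:R / rho) * (x - c)) @[n --> \oo] --> ((c < x)%R%:R : R).
  have [xc|cx] := leP x c.
    rewrite [X in X @ _ --> _](_ : _ = cst 0); first exact: cvg_cst.
    apply/funext => n; rewrite K0// mulr_ge0_le0 ?subr_le0//.
    by rewrite divr_ge0// ltW.
  apply: cvg_near_cst; near=> n; apply: K1.
  rewrite -ltr_pdivrMr ?subr_gt0// ltr_pdivlMr//.
  apply: (@lt_trans _ _ n%:R); last by rewrite ltr_nat.
  near: n; exact: nbhs_infty_gtr.
have -> : ind p q x = (p < x)%R%:R - (q < x)%R%:R :> R.
  rewrite /ind ltNge; have [xp|px] := leP x p.
    by rewrite /= ltNge (le_trans xp (ltW pq)) subr0.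
  by have [xq|xq] := leP x q; rewrite /= ?subr0 ?subrr.
by apply: cvgB; exact: Kcvg.
Unshelve. all: end_near. Qed.


(** [E n p q] tends to the indicator of [`]p, q]]. Its primitive [D n p q] is
    exactly [q - p] on the right, since there it is the difference of two
    rescaled ramps in their linear range. *)
Lemma ramp_family_exists (rho : R) : 0 < rho ->
  exists D E : nat -> R -> R -> R -> R, exists2 C, 0 <= C &
  forall p q, p < q -> forall n,
  [/\ smooth (D n p q), smooth (E n p q),
      forall x : R, is_derive x 1 (D n p q) (E n p q x) & forall x, `|E n p q x| <= C] /\
  [/\ forall x, x <= p -> D n p q x = 0 /\ E n p q x = 0,
      forall x, q + rho < x -> D n p q x = q - p /\ E n p q x = 0 &
      forall x, E n p q x @[n --> \oo] --> ind p q x].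
Proof.
move=> rho0.
have [P [K [sP sK dP [P0 P1] [K0 K1 [M KM]]]]] := @smooth_ramp_exists R.
pose L n : R := n.+1%:R / rho.
have L0 n : 0 < L n by rewrite divr_gt0.
have L1 n : 1 <= L n * rho by rewrite divfK ?gt_eqF// ler1n.
have sL n c : smooth (fun x => L n * (x - c)).
  have := smooth_affine (L n) (- (L n * c)).
  by congr (smooth _); apply/funext => x; rewrite mulrBr.
have dL n (c x : R) : is_derive x 1 (fun x => L n * (x - c)) (L n).
  have := is_deriveZ (L n) (is_deriveB (is_derive_id x 1) (is_derive_cst (c : R) x 1)).
  by rewrite subr0 /GRing.scale/= mulr1.
pose F n c x := (L n)^-1 * P (L n * (x - c)).
have sF n c : smooth (F n c) by exact: smoothM (smooth_cst _) (smooth_comp sP (sL n c)).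
have sG n c : smooth (fun x => K (L n * (x - c))) by exact: smooth_comp sK (sL n c).
have dF n (c x : R) : is_derive x 1 (F n c) (K (L n * (x - c))).
  have := is_deriveZ (L n)^-1 (@is_derive1_comp _ P (fun y => L n * (y - c)) x _ _
    (dP (L n * (x - c))) (dL n c x)).
  by rewrite /GRing.scale/= mulrCA mulVf ?mulr1 ?gt_eqF.
exists (fun n p q x => F n p x - F n q x).
exists (fun n p q x => K (L n * (x - p)) - K (L n * (x - q))).
exists (M + M); first by rewrite addr_ge0// (le_trans _ (KM 0)).
have smoothB (f g : R -> R) : smooth f -> smooth g -> smooth (fun x => f x - g x).
  move=> sf sg; have := smoothD sf (smoothM (smooth_cst (-1)) sg).
  by congr (smooth _); apply/funext => x; rewrite mulN1r.
move=> p q pq n; split; split.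
- exact: smoothB.
- exact: smoothB.
- by move=> x; exact: is_deriveB.
- by move=> x; rewrite (le_trans (ler_normB _ _))// lerD.
- move=> x xp; have xq := le_trans xp (ltW pq).
  have neg c : x <= c -> L n * (x - c) <= 0.
    by move=> xc; rewrite mulr_ge0_le0 ?subr_le0// ltW.
  by rewrite /F !P0 ?neg// !K0 ?neg// !mulr0 !subrr.
- move=> x qx.
  have big c : c <= q -> 1 < L n * (x - c).
    by move=> cq; rewrite (le_lt_trans (L1 n))// ltr_pM2l// ltrBrDl; lra.
  rewrite /F !P1 ?ltW ?big ?(ltW pq)// !K1 ?big ?(ltW pq)// subrr; split => //.
  by rewrite !mulKf ?gt_eqF//; lra.
- by move=> x; exact: ramp_diff_cvg.
Qed.

End ramp_family.

Section constancy.
Context {R : realType} {Omega : set (R * R)} {oOmega : open Omega}.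
Notation leb := (leb_on oOmega).
Variable h : plane R -> R.
Hypothesis ih : leb.-integrable setT (EFin \o h).
Hypothesis h_grad0 : forall i phi, test_function Omega phi ->
  (\int[leb]_z (h z * partial i phi z)%:E = 0)%E.

(** Dominated convergence: the weak equation passes to discontinuous limits of
    derivatives of test functions. *)
Lemma weak_limit_eq0 (psi : (R * R -> R)^nat) (psi0 : plane R -> R) M :
  (forall n, continuous (psi n)) ->
  (forall n z, `|psi n z| <= M) ->
  (forall z, psi n z @[n --> \oo] --> psi0 z) ->
  (forall n, \int[leb]_z (h z * psi n z)%:E = 0)%E ->
  (\int[leb]_z (h z * psi0 z)%:E = 0)%E.
Proof.
move=> cpsi psiM psi_psi0 hpsi.
have mpsi n : measurable_fun setT (psi n : plane R -> R).
  exact: continuous_measurable_plane.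
have mpsi0 : measurable_fun setT psi0.
  by apply: (@measurable_fun_cvg _ _ _ setT psi psi0) => // z _; exact: psi_psi0.
have mh : measurable_fun setT h by apply/measurable_EFinP; exact: measurable_int ih.
have [] := @dominated_convergence _ _ _ leb setT measurableT
  (fun n z => (h z * psi n z)%:E) (fun z => (h z * psi0 z)%:E)
  (fun z => `|h z|%:E * M%:E)%E.
- by move=> n; apply/measurable_EFinP; exact: measurable_funM.
- by apply/measurable_EFinP; exact: measurable_funM.
- apply: aeW => z _; apply: cvg_EFin; first exact: nearW.
  by apply: cvgMl_tmp; exact: psi_psi0.
- apply: integrableZr => //; exact: integrable_abse ih.
- apply: aeW => z n _; rewrite abse_EFin -EFinM lee_fin normrM.
  by rewrite ler_wpM2l.
move=> _ _; rewrite (_ : [sequence _]_n = cst 0%E); last first.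
  by apply/funext => n; exact: hpsi.
move=> /(cvg_lim (@ereal_hausdorff R)) <-.
by apply/cvg_lim; [exact: ereal_hausdorff|exact: cvg_cst].
Qed.


Definition normalized_diff (a b p q x : R) : R := ind p q x / (q - p) - ind a b x / (b - a).

(** Both normalised primitives are equal to 1 to the right of their intervals,
    so that their difference has compact support and is a factor of a test
    function. *)
Lemma normalized_diff_family (a b p q rho : R) :
    a <= p -> p < q -> q <= b -> 0 < rho ->
  exists A A' : nat -> R -> R, exists2 C, 0 <= C &
  [/\ forall n, smooth (A n) /\ smooth (A' n),
      forall n (x : R), is_derive x 1 (A n) (A' n x),
      forall n x, ~~ (a <= x <= b + rho) -> A n x = 0,
      forall n x, `|A' n x| <= C &
      forall x, A' n x @[n --> \oo] --> normalized_diff a b p q x].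
Proof.
move=> ap pq qb rho0.
have ab : a < b by rewrite (le_lt_trans ap)// (lt_le_trans pq).
have [D [E [C C0 HDE]]] := ramp_family_exists rho0.
exists (fun n x => (q - p)^-1 * D n p q x + - (b - a)^-1 * D n a b x).
exists (fun n x => (q - p)^-1 * E n p q x + - (b - a)^-1 * E n a b x).
exists (`|(q - p)^-1| * C + `|- (b - a)^-1| * C); first by rewrite addr_ge0// mulr_ge0.
split.
- move=> n; have [[sD sE _ _] _] := HDE _ _ pq n; have [[sD' sE' _ _] _] := HDE _ _ ab n.
  by split; (apply: smoothD; apply: smoothM => //; exact: smooth_cst).
- move=> n x; have [[_ _ dD _] _] := HDE _ _ pq n; have [[_ _ dD' _] _] := HDE _ _ ab n.
  exact: is_deriveD (is_deriveZ (q - p)^-1 (dD x)) (is_deriveZ (- (b - a)^-1) (dD' x)).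
- move=> n x; have [_ [D0 D1 _]] := HDE _ _ pq n; have [_ [D0' D1' _]] := HDE _ _ ab n.
  rewrite negb_and -!ltNge => /orP[xa|bx].
    by rewrite (D0 x _).1 ?(D0' x _).1 ?mulr0 ?addr0 ?(ltW xa)// (le_trans (ltW xa)).
  rewrite (D1 x _).1 ?(D1' x _).1//; last by rewrite (le_lt_trans _ bx)// lerD2r.
  by rewrite mulNr !mulVf ?subrr// subr_eq0 gt_eqF.
- move=> n x; have [[_ _ _ EC] _] := HDE _ _ pq n; have [[_ _ _ EC'] _] := HDE _ _ ab n.
  by rewrite (le_trans (ler_normD _ _))// !normrM lerD// ler_wpM2l.
- move=> x; have [_ [_ _ Ecvg]] := HDE _ _ pq 0%N; have [_ [_ _ Ecvg']] := HDE _ _ ab 0%N.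
  rewrite /normalized_diff ![_ / (_ - _)]mulrC -mulNr.
  by apply: cvgD; apply: cvgMl_tmp; [exact: Ecvg|exact: Ecvg'].
Qed.

Lemma ind_family (r s rho : R) : r < s -> 0 < rho ->
  exists B : nat -> R -> R, exists2 C, 0 <= C &
  [/\ forall n, smooth (B n), forall n x, ~~ (r <= x <= s + rho) -> B n x = 0,
      forall n x, `|B n x| <= C & forall x, B n x @[n --> \oo] --> ind r s x].
Proof.
move=> rs rho0; have [D [E [C C0 HDE]]] := ramp_family_exists rho0.
exists (fun n => E n r s), C => //; split.
- by move=> n; have [[_ + _ _] _] := HDE _ _ rs n.
- move=> n x; have [_ [E0 E1 _]] := HDE _ _ rs n.
  rewrite negb_and -!ltNge => /orP[xr|sx]; first by rewrite (E0 x _).2 ?ltW.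
  by rewrite (E1 x _).2.
- by move=> n; have [[_ _ _ +] _] := HDE _ _ rs n.
- by have [_ [_ _ +]] := HDE _ _ rs 0%N.
Qed.

(** The mean of [h] over a box does not change when its first side varies. The
    margin [rho] leaves room for the supports of the smooth approximations,
    which stick out of the intervals on the right. *)
Lemma box_gradient1 (a b p q r s rho : R) :
  a <= p -> p < q -> q <= b -> r < s -> 0 < rho ->
  `[a, b + rho] `*` `[r, s + rho] `<=` Omega ->
  (\int[leb]_z (h z * (normalized_diff a b p q z.1 * ind r s z.2))%:E = 0)%E.
Proof.
move=> ap pq qb rs rho0 KO.
have [A [A' [C C0 [sA dA A0 A'C A'cvg]]]] := normalized_diff_family ap pq qb rho0.
have [B [C' C'0 [sB B0 BC' Bcvg]]] := ind_family rs rho0.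
apply: (@weak_limit_eq0 (fun n => tensor (A' n) (B n)) _ (C * C')).
- move=> n; apply: continuous_tensor; apply: smooth_continuous => //.
  by have [] := sA n.
- by move=> n z; rewrite normrM ler_pM.
- by move=> z; apply: cvgM.
- move=> n; rewrite -(partial_tensor1 (B n) (dA n)); apply: h_grad0.
  by apply: test_function_tensor (A0 n) (B0 n) KO => //; have [] := sA n.
Qed.

Lemma box_gradient2 (a b p q r s rho : R) :
  a <= p -> p < q -> q <= b -> r < s -> 0 < rho ->
  `[r, s + rho] `*` `[a, b + rho] `<=` Omega ->
  (\int[leb]_z (h z * (ind r s z.1 * normalized_diff a b p q z.2))%:E = 0)%E.
Proof.
move=> ap pq qb rs rho0 KO.
have [A [A' [C C0 [sA dA A0 A'C A'cvg]]]] := normalized_diff_family ap pq qb rho0.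
have [B [C' C'0 [sB B0 BC' Bcvg]]] := ind_family rs rho0.
apply: (@weak_limit_eq0 (fun n => tensor (B n) (A' n)) _ (C' * C)).
- move=> n; apply: continuous_tensor; apply: smooth_continuous => //.
  by have [] := sA n.
- by move=> n z; rewrite normrM ler_pM.
- by move=> z; apply: cvgM.
- move=> n; rewrite -(partial_tensor2 (B n) (dA n)); apply: h_grad0.
  by apply: test_function_tensor (B0 n) (A0 n) KO => //; have [] := sA n.
Qed.

End constancy.

(** * Charges that vanish on boxes *)

Section charge_generators.
Local Open Scope ereal_scope.

(** The sets [X] with [nu (f @^-1` X `&` Z) = 0] form a Dynkin system; the slice
    [Z] lets one coordinate be treated while the other one is kept. *)
Lemma charge_preimage_eq0 d d' (T : measurableType d) (T' : measurableType d')
    (R : realType) (nu : {charge set T' -> \bar R}) (f : T' -> T) (Z : set T')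
    (G : set (set T)) :
  @measurable _ T = <<s G >> -> setI_closed G -> measurable_fun setT f ->
  measurable Z -> nu Z = 0 -> (forall X, G X -> nu (f @^-1` X `&` Z) = 0) ->
  forall X, measurable X -> nu (f @^-1` X `&` Z) = 0.
Proof.
move=> TG GI mf mZ nuZ nuG X; rewrite TG.
have mpre S : measurable S -> measurable (f @^-1` S `&` Z).
  by move=> mS; apply: measurableI => //; rewrite -[X in measurable X]setTI; exact: mf.
apply: (@dynkin_induction _ T G (fun X => nu (f @^-1` X `&` Z) = 0) TG GI) => //.
- by rewrite preimage_setT setTI.
- move=> S mS nuS; rewrite preimage_setC setIC -setDE.
  rewrite chargeD//; last by rewrite -[X in measurable X]setTI; exact: mf.
  by rewrite nuZ setIC nuS sube0.
- move=> F mF tF nuF; rewrite preimage_bigcup setI_bigcupl.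
  have mU : measurable (\bigcup_k (f @^-1` F k `&` Z)).
    by apply: bigcup_measurable => k _; exact: mpre.
  have := @charge_semi_sigma_additive _ _ _ nu (fun k => f @^-1` F k `&` Z)
    (fun k => mpre _ (mF k)) _ mU.
  have tFZ : trivIset setT (fun k => f @^-1` F k `&` Z).
    apply/trivIsetP => i j _ _ ij; rewrite setIACA setIid -preimage_setI.
    by move/trivIsetP : tF => /(_ i j Logic.I Logic.I ij) ->; rewrite preimage_set0 set0I.
  move=> /(_ tFZ) /(cvg_lim (@ereal_hausdorff R)) <-.
  apply/cvg_lim; first exact: ereal_hausdorff.
  rewrite [X in X @ _ --> _](_ : _ = cst 0); first exact: cvg_cst.
  by apply/funext => n; rewrite big1// => i _; exact: nuF.
Qed.

(** From half-open intervals to measurable sets in the first coordinate, then in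
    the second one, then from rectangles to measurable sets of the plane. *)
Lemma charge_box_eq0 (R : realType) (nu : {charge set (plane R) -> \bar R}) :
  (forall X Y : set R, ocitv X \/ X = setT -> ocitv Y \/ Y = setT ->
    nu ((X : set (measurableTypeR R)) `*` (Y : set (measurableTypeR R))) = 0) ->
  forall A, measurable A -> nu A = 0.
Proof.
move=> nu0.
have RG : @measurable _ (measurableTypeR R) = <<s @ocitv R >> by [].
have mfst : measurable_fun setT (fst : plane R -> measurableTypeR R) by exact: measurable_fst.
have msnd : measurable_fun setT (snd : plane R -> measurableTypeR R) by exact: measurable_snd.
have prodE (X Y : set (measurableTypeR R)) :
    fst @^-1` X `&` snd @^-1` Y = X `*` Y :> set (plane R).
  by apply/seteqP; split.
have mocitv (Y : set (measurableTypeR R)) : ocitv Y \/ Y = setT -> measurable Y.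
  by case=> [oY|->]; [exact: sub_sigma_algebra|exact: measurableT].
have nuXY (X Y : set (measurableTypeR R)) : measurable X -> ocitv Y \/ Y = setT ->
    nu (X `*` Y) = 0.
  move=> mX oY; rewrite -prodE.
  apply: (charge_preimage_eq0 RG (@ocitvI R) mfst) => //.
  - by rewrite -[X in measurable X]setTI; apply: msnd => //; exact: mocitv.
  - by rewrite -[snd @^-1` Y]setTI -(preimage_setT fst) prodE nu0//; right.
  - by move=> X' oX'; rewrite prodE nu0//; left.
have nuXY' (X Y : set (measurableTypeR R)) : measurable X -> measurable Y ->
    nu (X `*` Y) = 0.
  move=> mX mY; rewrite -prodE setIC.
  apply: (charge_preimage_eq0 RG (@ocitvI R) msnd) => //.
  - by rewrite -[X in measurable X]setTI; exact: mfst.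
  - by rewrite -[fst @^-1` X]setIT -(preimage_setT snd) prodE nuXY//; right.
  - by move=> Y' oY'; rewrite setIC prodE nuXY//; left.
move=> A mA.
have := @charge_preimage_eq0 _ _ _ _ _ nu id setT _
  (@measurable_prod_measurableType _ _ (measurableTypeR R) (measurableTypeR R)).
move=> /(_ _ (@measurable_id _ _ _) measurableT).
have -> : nu setT = 0 by rewrite -setXTT nuXY'.
move=> H; rewrite -[A]setIT; apply: H => //.
  move=> _ _ [X1 mX1 [Y1 mY1 <-]] [X2 mX2 [Y2 mY2 <-]].
  exists (X1 `&` X2); first exact: measurableI.
  by exists (Y1 `&` Y2); [exact: measurableI|rewrite setXI].
by move=> _ [X mX [Y mY <-]]; rewrite setIT nuXY'.
Qed.

End charge_generators.

(** * Functions with zero weak gradient are locally constant *)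

Section local_constancy.
Context {R : realType} {Omega : set (R * R)} {oOmega : open Omega}.
Notation leb := (leb_on oOmega).
Hypothesis leb_fin : (leb setT < +oo)%E.
Variable h : plane R -> R.
Hypothesis ih : leb.-integrable setT (EFin \o h).
Hypothesis h_grad0 : forall i phi, test_function Omega phi ->
  (\int[leb]_z (h z * partial i phi z)%:E = 0)%E.

Definition box (p q r s : R) : set (plane R) := `]p, q] `*` `]r, s].

Lemma measurable_box p q r s : measurable (box p q r s).
Proof. by apply: measurableX; exact: measurable_itv. Qed.

Lemma box_indE p q r s z : ind p q z.1 * ind r s z.2 = \1_(box p q r s) z.
Proof.
rewrite indicE /ind -natrM mulnb; congr (_%:R); congr nat_of_bool.
apply/idP/idP => [/andP[zpq zrs]|]; first by rewrite inE; split; rewrite /= in_itv.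
by rewrite inE => -[/=]; rewrite !in_itv/= => -> ->.
Qed.

Lemma leb_box p q r s : p <= q -> r <= s -> box p q r s `<=` Omega ->
  leb (box p q r s) = ((q - p) * (s - r))%:E.
Proof.
move=> pq rs bO; rewrite /leb_on /mrestr (setIidl bO).
have E (x y : R) : x <= y -> lebesgue_measure (`]x, y]%classic : set R) = (y - x)%:E.
  rewrite le_eqVlt lebesgue_measure_itv/= lte_fin => /predU1P[->|xy].
    by rewrite ltxx subrr.
  by rewrite xy EFinB.
apply: etrans (_ : lebesgue_measure (`]p, q]%classic : set R) *
  lebesgue_measure (`]r, s]%classic : set R) = _)%E.
  by apply: product_measure1E; exact: measurable_itv.
by rewrite (E p q)// (E r s)// EFinM.
Qed.

Lemma integrable_mul_indic (A : set (plane R)) : measurable A ->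
  leb.-integrable setT (fun z => (h z * \1_A z)%:E).
Proof.
move=> mA; under eq_fun do rewrite mulrC EFinM.
apply: integrableMr => //.
exists 1; split; first exact: num_real.
move=> N N1 z _ /=; rewrite (le_trans _ (ltW N1))//.
by rewrite indicE ger0_norm// lern1 leq_b1.
Qed.

Definition boxint (p q r s : R) : R := fine (\int[leb]_z (h z * \1_(box p q r s) z)%:E).

Lemma boxintE p q r s :
  (\int[leb]_z (h z * \1_(box p q r s) z)%:E)%E = (boxint p q r s)%:E.
Proof.
rewrite fineK// integrable_fin_num//.
by apply: integrable_mul_indic; exact: measurable_box.
Qed.

Lemma boxint_combination (x y : R) (A A' : set (plane R)) : measurable A -> measurable A' ->
  (\int[leb]_z (h z * (x * \1_A z - y * \1_A' z))%:E =
   x%:E * \int[leb]_z (h z * \1_A z)%:E - y%:E * \int[leb]_z (h z * \1_A' z)%:E)%E.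
Proof.
move=> mA mA'; have iA := integrable_mul_indic mA; have iA' := integrable_mul_indic mA'.
transitivity (\int[leb]_z ((x%:E * (h z * \1_A z)%:E) - (y%:E * (h z * \1_A' z)%:E)))%E.
  by apply: eq_integral => z _; rewrite -!EFinM -EFinB; congr EFin; ring.
by rewrite integralB//; [rewrite !integralZl|exact: integrableZl|exact: integrableZl].
Qed.

Section on_box.
Variables (a b c d rho : R).
Hypotheses (ab : a < b) (cd : c < d) (rho0 : 0 < rho).
Hypothesis KO : `[a, b + rho] `*` `[c, d + rho] `<=` Omega.

Lemma sub_closed_box p q r s : a <= p -> q <= b -> c <= r -> s <= d ->
  `[p, q + rho] `*` `[r, s + rho] `<=` Omega.
Proof.
move=> ap qb cr sd [x y] /= [xpq yrs]; apply: KO; move: xpq yrs.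
rewrite /= !in_itv/= => /andP[px xq] /andP[ry ys]; split.
  by rewrite (le_trans ap px) (le_trans xq)// lerD2r.
by rewrite (le_trans cr ry) (le_trans ys)// lerD2r.
Qed.

Lemma box_sub p q r s : a <= p -> q <= b -> c <= r -> s <= d -> box p q r s `<=` Omega.
Proof.
move=> ap qb cr sd; apply: subset_trans (sub_closed_box ap qb cr sd).
move=> [x y] /= [xpq yrs]; move: xpq yrs.
rewrite /= !in_itv/= => /andP[px xq] /andP[ry ys]; split.
  by rewrite (ltW px) (le_trans xq)// lerDl ltW.
by rewrite (ltW ry) (le_trans ys)// lerDl ltW.
Qed.

Lemma boxint_normalized1 p q r s : a <= p -> p < q -> q <= b ->
  c <= r -> r < s -> s <= d -> boxint p q r s / (q - p) = boxint a b r s / (b - a).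
Proof.
move=> ap pq qb cr rs sd.
have := box_gradient1 ih h_grad0 ap pq qb rs rho0 (sub_closed_box (lexx a) (lexx b) cr sd).
rewrite (eq_integral (fun z => (h z * ((q - p)^-1 * \1_(box p q r s) z -
    (b - a)^-1 * \1_(box a b r s) z))%:E)); last first.
  move=> z _; congr EFin; congr (_ * _).
  by rewrite -!box_indE /normalized_diff; ring.
rewrite boxint_combination; [|exact: measurable_box..].
rewrite !boxintE -!EFinM -EFinB => -[] /eqP; rewrite subr_eq0 => /eqP.
by rewrite ![(_ - _)^-1 * _]mulrC.
Qed.

Lemma boxint_normalized2 p q r s : a <= p -> p < q -> q <= b ->
  c <= r -> r < s -> s <= d -> boxint p q r s / (s - r) = boxint p q c d / (d - c).
Proof.
move=> ap pq qb cr rs sd.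
have := box_gradient2 ih h_grad0 cr rs sd pq rho0 (sub_closed_box ap qb (lexx c) (lexx d)).
rewrite (eq_integral (fun z => (h z * ((s - r)^-1 * \1_(box p q r s) z -
    (d - c)^-1 * \1_(box p q c d) z))%:E)); last first.
  move=> z _; congr EFin; congr (_ * _).
  by rewrite -!box_indE /normalized_diff; ring.
rewrite boxint_combination; [|exact: measurable_box..].
rewrite !boxintE -!EFinM -EFinB => -[] /eqP; rewrite subr_eq0 => /eqP.
by rewrite ![(_ - _)^-1 * _]mulrC.
Qed.

Let kappa := boxint a b c d / ((b - a) * (d - c)).

Lemma boxint_proportional p q r s : a <= p -> p < q -> q <= b ->
  c <= r -> r < s -> s <= d -> boxint p q r s = kappa * ((q - p) * (s - r)).
Proof.
move=> ap pq qb cr rs sd.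
have e1 := boxint_normalized1 ap pq qb cr rs sd.
have e2 := boxint_normalized2 (lexx a) ab (lexx b) cr rs sd.
have qp0 : q - p != 0 by rewrite subr_eq0 gt_eqF.
have sr0 : s - r != 0 by rewrite subr_eq0 gt_eqF.
have ba0 : b - a != 0 by rewrite subr_eq0 gt_eqF.
have dc0 : d - c != 0 by rewrite subr_eq0 gt_eqF.
move/(canRL (divfK qp0)) : e1 => ->; move/(canRL (divfK sr0)) : e2 => ->.
by rewrite /kappa; field; apply/andP.
Qed.

Let excess z := (h z - kappa) * \1_(box a b c d) z.

Let indic_integrable (x : R) (A : set (plane R)) : measurable A ->
  leb.-integrable setT (fun z => (x * \1_A z)%:E).
Proof.
move=> mA; apply: (@bounded_integrable _ _ _ leb (fun z => x * \1_A z) `|x|) => //.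
  by apply: measurable_funM.
by move=> z; rewrite normrM ler_piMr// indicE ger0_norm// lern1 leq_b1.
Qed.

Let excess_integrable : leb.-integrable setT (EFin \o excess).
Proof.
have mb := measurable_box a b c d.
apply: eq_integrable (integrableB measurableT (integrable_mul_indic mb)
  (indic_integrable kappa mb)) => //.
by move=> z _; rewrite /= /excess mulrBl EFinB.
Qed.

Lemma integral_excess_box p q r s : a <= p -> p < q -> q <= b ->
  c <= r -> r < s -> s <= d ->
  (\int[leb]_z ((h z - kappa) * \1_(box p q r s) z)%:E = 0)%E.
Proof.
move=> ap pq qb cr rs sd; have mb := measurable_box p q r s.
transitivity (\int[leb]_z ((h z * \1_(box p q r s) z)%:E -
    (kappa * \1_(box p q r s) z)%:E))%E.
  by apply: eq_integral => z _; rewrite -EFinB mulrBl.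
rewrite integralB//; [|exact: integrable_mul_indic|exact: indic_integrable].
rewrite boxintE boxint_proportional//.
under [X in (_ - X)%E]eq_integral do rewrite EFinM.
have i1 : leb.-integrable setT (fun z => (\1_(box p q r s) z)%:E).
  by have := indic_integrable 1 mb; under eq_fun do rewrite mul1r.
rewrite integralZl// integral_indic// setIT.
rewrite [X in (_ - _ * X)%E](leb_box (ltW pq) (ltW rs) (box_sub ap qb cr sd)).
by rewrite -EFinM -EFinB subrr.
Qed.

(** The charge of density [h - kappa] on the box vanishes on smaller boxes by
    [boxint_proportional]. Any box meets the given one in a box, so the charge
    vanishes on all boxes, hence on all measurable sets. *)
Lemma ae_cst_on_box : exists k : R, {ae leb, forall z, box a b c d z -> h z = k}.
Proof.
exists kappa.
pose nu : {charge set (plane R) -> \bar R} := induced_charge excess_integrable.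
have nu0 A : measurable A -> nu A = 0%E.
  apply: charge_box_eq0 => X Y oX oY.
  have ocI (Z : set R) (x y : R) : ocitv Z \/ Z = setT -> ocitv (`]x, y] `&` Z).
    by case=> [oZ|->]; [exact: (ocitvI (is_ocitv x y) oZ)|rewrite setIT; exact: is_ocitv].
  have itv_sub (x y p q : R) : p < q -> `]p, q]%classic `<=` `]x, y]%classic ->
      x <= p /\ q <= y.
    move=> pq sub; split; last first.
      have := sub q; rewrite /= !in_itv/= pq lexx => /(_ isT) /andP[].
      by [].
    rewrite leNgt; apply/negP => px.
    have := sub (Num.min x q); rewrite /= !in_itv/= lt_min px pq ge_min lexx orbT.
    by move=> /(_ isT) /andP[]; rewrite lt_min ltxx.
  have -> : nu (X `*` Y) =
      (\int[leb]_z ((h z - kappa) * \1_((`]a, b] `&` X) `*` (`]c, d] `&` Y)) z)%:E)%E.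
    rewrite [LHS]integral_mkcond; apply: eq_integral => z _.
    rewrite patchE /= /excess /box setXI !indicE in_setI.
    by case: (z \in X `*` Y); rewrite ?andbT ?andbF// mulr0.
  have subX : `]a, b] `&` X `<=` `]a, b] by exact: subIsetl.
  have subY : `]c, d] `&` Y `<=` `]c, d] by exact: subIsetl.
  have zero (B : set (plane R)) : B = set0 ->
      (\int[leb]_z ((h z - kappa) * \1_B z)%:E = 0)%E.
    by move=> ->; apply: integral0_eq => z _; rewrite indic0 mulr0.
  move: subX subY.
  have /ocitvP[->|[[p q] /= pq ->]] := ocI X a b oX.
    by move=> _ _; rewrite zero// set0X.
  have /ocitvP[->|[[r s] /= rs ->]] := ocI Y c d oY.
    by move=> _ _; rewrite zero// setX0.
  move=> /itv_sub[]// ap qb /itv_sub[]// cr sd.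
  exact: integral_excess_box.
have : ae_eq leb setT (EFin \o excess) (cst 0%E).
  apply: integral_ae_eq => // A _ mA; rewrite integral0.
  exact: nu0.
apply: filterS => z /(_ Logic.I) /= [] + zb.
rewrite /excess indicE mem_set// mulr1 => /eqP.
by rewrite subr_eq0 => /eqP.
Qed.

End on_box.
End local_constancy.

(** * Functions with zero weak gradient are constant on connected sets *)

Section global_constancy.
Context {R : realType} {Omega : set (R * R)} {oOmega : open Omega}.
Notation leb := (leb_on oOmega).
Hypothesis leb_fin : (leb setT < +oo)%E.
Variable h : plane R -> R.
Hypothesis ih : leb.-integrable setT (EFin \o h).
Hypothesis h_grad0 : forall i phi, test_function Omega phi ->
  (\int[leb]_z (h z * partial i phi z)%:E = 0)%E.

Lemma ae_leb_on : {ae leb, forall z : plane R, Omega z}.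
Proof.
exists (~` Omega); split => //.
- exact: (measurableC (open_measurable_plane oOmega)).
- by rewrite /leb_on /mrestr setICl; exact: measure0.
Qed.

Lemma open_ball_plane (z : R * R) (e : R) : open (ball z e).
Proof.
have -> : ball z e = fst @^-1` ball z.1 e `&` snd @^-1` ball z.2 e.
  by apply/seteqP; split.
apply: openI; apply: open_comp; try exact: ball_open.
  by move=> y _; exact: cvg_fst.
by move=> y _; exact: cvg_snd.
Qed.

Definition ae_cst_on (A : set (R * R)) (k : R) :=
  {ae leb, forall z : plane R, A z -> h z = k}.

Lemma ae_cst_onS (A B : set (R * R)) k : A `<=` B -> ae_cst_on B k -> ae_cst_on A k.
Proof. by move=> AB; apply: filterS => z hz /AB. Qed.

Lemma ae_cst_on_ball z : Omega z -> exists2 e : R, 0 < e &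
  exists k, ae_cst_on (ball z e) k.
Proof.
case: z => x y Oz.
have /nbhs_ballP[e /= e0 eO] := open_nbhs_nbhs (conj oOmega Oz).
have [rho rho0 eE] : exists2 rho : R, 0 < rho & e = 4 * rho.
  by exists (e / 4); [rewrite divr_gt0|rewrite mulrC divfK].
exists rho => //.
have KO : `[x - rho, (x + rho) + rho] `*` `[y - rho, (y + rho) + rho] `<=` Omega.
  move=> [s t] /= [xs yt]; apply: eO; move: xs yt.
  rewrite /= !in_itv/= => /andP[? ?] /andP[? ?].
  by split; rewrite /ball/= ltr_norml; apply/andP; split; lra.
have xx : x - rho < x + rho by lra.
have yy : y - rho < y + rho by lra.
have [k hk] := ae_cst_on_box leb_fin ih h_grad0 xx yy rho0 KO.
exists k; apply: filterS hk => -[s t] hk [/= xs yt]; apply: hk.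
move: xs yt; rewrite /ball/= !ltr_norml => /andP[? ?] /andP[? ?].
by split; rewrite /= in_itv/=; apply/andP; split; lra.
Qed.

(** Otherwise a box contained in [A `&` Omega] would be negligible. *)
Lemma ae_cst_on_unique (A : set (R * R)) z k k' : open A -> Omega z -> A z ->
  ae_cst_on A k -> ae_cst_on A k' -> k = k'.
Proof.
move=> oA Oz Az hk hk'; apply: contrapT => kk'.
have oAO : open (A `&` Omega) by exact: openI.
have /nbhs_ballP[e /= e0 eA] := open_nbhs_nbhs (conj oAO (conj Az Oz)).
case: z => x y in Oz Az eA *.
have [d d0 eE] : exists2 d : R, 0 < d & e = 2 * d.
  by exists (e / 2); [rewrite divr_gt0|rewrite mulrC divfK].
have bA : box (x - d) (x + d) (y - d) (y + d) `<=` A `&` Omega.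
  move=> [s t] /= [xs yt]; apply: eA; move: xs yt.
  rewrite /= !in_itv/= => /andP[? ?] /andP[? ?].
  by split; rewrite /ball/= ltr_norml; apply/andP; split; lra.
have xx : x - d < x + d by lra.
have yy : y - d < y + d by lra.
have /(measure_negligible (measurable_box _ _ _ _)) :
    leb.-negligible (box (x - d) (x + d) (y - d) (y + d)).
  apply: negligibleS (filterI hk hk') => z bz /= -[h1 h2].
  by apply: kk'; rewrite -h1 ?h2//; case: (bA _ bz).
have bO : box (x - d) (x + d) (y - d) (y + d) `<=` Omega by move=> w /bA[].
move=> b0; have := leb_box (oOmega := oOmega) (ltW xx) (ltW yy) bO.
rewrite [LHS]b0 => -[] /esym/eqP; rewrite mulf_eq0 => /orP[] /eqP; lra.
Qed.

Definition rat_box (q : (rat * rat * rat)%type) : set (R * R) :=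
  ball (ratr q.1.1 : R) (ratr q.2) `*` ball (ratr q.1.2 : R) (ratr q.2).

Lemma rat_box_ball z (e : R) : 0 < e ->
  exists q, rat_box q z /\ rat_box q `<=` ball z e.
Proof.
case: z => x y e0.
have [r /andP[r0 re]] : exists r : rat, 0 < (ratr r : R) < e / 2.
  have [r] := rat_in_itvoo (divr_gt0 e0 (@ltr0Sn R 1)).
  by rewrite in_itv/=; exists r.
have rat_near (t : R) : exists q : rat, `|ratr q - t| < ratr r.
  have [|q] := @rat_in_itvoo R (t - ratr r) (t + ratr r).
    by rewrite ltrD2l gt0_cp.
  rewrite in_itv/= => /andP[q1 q2]; exists q.
  by rewrite ltr_norml; apply/andP; split; lra.
have [q1 q1x] := rat_near x; have [q2 q2y] := rat_near y.
exists (q1, q2, r); split => // -[s t] [/= qs qt]; split.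
  move: qs q1x; rewrite /ball/= !ltr_norml => /andP[? ?] /andP[? ?].
  by apply/andP; split; lra.
move: qt q2y; rewrite /ball/= !ltr_norml => /andP[? ?] /andP[? ?].
by apply/andP; split; lra.
Qed.

(** The balls are refined to boxes with rational data, of which there are
    countably many. *)
Lemma ae_cst_on_lindelof k :
  (forall z, Omega z -> exists2 e : R, 0 < e & ae_cst_on (ball z e) k) ->
  ae_cst_on Omega k.
Proof.
move=> hk.
pose good q := ae_cst_on (rat_box q) k.
have : {ae leb, forall (z : plane R) (n : nat), if unpickle n is Some q then
    good q -> rat_box q z -> h z = k else True}.
  apply: ae_foralln => n; case: (unpickle n) => [q|]; last exact: aeW.
  have [gq|ngq] := pselect (good q); last by apply: aeW => z /ngq.
  by apply: filterS gq => z hz _.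
apply: filterS => z hz Oz; have [e e0 he] := hk z Oz.
have [q [qz qe]] := rat_box_ball z e0.
have := hz (pickle q); rewrite pickleK; apply => //.
exact: ae_cst_onS he.
Qed.

(** The points near which [h] is equal to the constant found at one point form
    an open subset of [Omega]. It is also closed in [Omega]: at a limit point,
    the local constant agrees with it on the overlap of two balls. *)
Lemma weak_grad0_cst : connected Omega -> exists k : R, {ae leb, forall z : plane R, h z = k}.
Proof.
move=> cO.
have aeO := ae_leb_on.
have FF : @Filter (R * R) (almost_everywhere leb) := ae_filter_ringOfSetsType leb.
have [[z0 Oz0]|O0] := pselect (Omega !=set0); last first.
  exists 0; move: aeO; apply: filterS => z Oz; exfalso; apply: O0; by exists z.
have [e0 e0_gt0 [k hk]] := ae_cst_on_ball Oz0.
exists k.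
suff : ae_cst_on Omega k.
  by move: aeO; apply: filterS2 => z Oz hz; exact: hz.
apply: ae_cst_on_lindelof.
pose B := [set z | Omega z /\ exists2 e : R, 0 < e & ae_cst_on (ball z e) k].
suff BO : B = Omega by move=> z; rewrite -BO => -[].
apply: cO.
- by exists z0; split => //; exists e0.
- exists B; last by apply/seteqP; split => [z [Oz ?]|z []].
  rewrite openE => z [Oz [e egt0 he]].
  have nO : nbhs z Omega by exact: open_nbhs_nbhs.
  have nb : nbhs z (ball z e) by exact: nbhsx_ballx.
  apply: filterS2 nO nb => y Oy zy.
  have /nbhs_ballP[e' /= e'0 e'sub] : nbhs y (ball z e).
    by apply: open_nbhs_nbhs; split => //; exact: open_ball_plane.
  by split => //; exists e' => //; exact: ae_cst_onS he.
- exists (closure B); first exact: closed_closure.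
  apply/seteqP; split => [z Bz|z [Oz Bz]].
    by split; [case: Bz|exact: subset_closure].
  have [e egt0 [k' hk']] := ae_cst_on_ball Oz.
  split => //; exists e => //.
  have [y [[Oy [e' e'0 he']] zy]] := Bz _ (nbhsx_ballx z e egt0).
  suff -> : k = k' by [].
  apply: (@ae_cst_on_unique (ball z e `&` ball y e') y) => //.
  + by apply: openI; exact: open_ball_plane.
  + by split => //; exact: ballxx.
  + by apply: ae_cst_onS he' => ? [].
  + by apply: ae_cst_onS hk' => ? [].
Qed.

End global_constancy.

(** * Square integrable functions and bounded operators *)

Section L2_functions.
Local Open Scope ereal_scope.
Context d (T : measurableType d) (R : realType) (mu : {measure set T -> \bar R}).
Implicit Types u v : T -> R.

Lemma Lfun2_measurable u : u \in Lfun mu 2%:E -> measurable_fun setT u.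
Proof. by rewrite inE => /andP[/[!inE]]. Qed.

Lemma Lfun2_lincomb (a : R) u v : u \in Lfun mu 2%:E -> v \in Lfun mu 2%:E ->
  (fun x => a * u x + v x)%R \in Lfun mu 2%:E.
Proof.
have p1 : 1 <= 2%:E :> \bar R by rewrite lee_fin ler1n.
exact: (Lfun_submod_closed mu p1).2.
Qed.

Lemma Lfun2_cst0 : (cst 0%R : T -> R) \in Lfun mu 2%:E.
Proof.
have p1 : 1 <= 2%:E :> \bar R by rewrite lee_fin ler1n.
exact: (Lfun_submod_closed mu p1).1.
Qed.

Lemma Lfun2_scale (a : R) u : u \in Lfun mu 2%:E -> (fun x => a * u x)%R \in Lfun mu 2%:E.
Proof.
move=> u2; rewrite (_ : (fun x => _) = (fun x => a * u x + cst 0 x)%R).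
  by apply: Lfun2_lincomb => //; exact: Lfun2_cst0.
by apply/funext => x; rewrite addr0.
Qed.

Lemma Lfun2B u v : u \in Lfun mu 2%:E -> v \in Lfun mu 2%:E ->
  (fun x => u x - v x)%R \in Lfun mu 2%:E.
Proof.
move=> u2 v2; rewrite (_ : (fun x => _) = (fun x => -1 * v x + u x)%R).
  exact: Lfun2_lincomb.
by apply/funext => x; rewrite mulN1r addrC.
Qed.

Lemma Lfun2_indic (A : set T) : mu setT < +oo -> measurable A ->
  (\1_A : T -> R) \in Lfun mu 2%:E.
Proof.
move=> muT mA; rewrite inE/=; apply/andP; split; rewrite inE//=.
rewrite /finite_norm unlock poweR_lty//; apply: integrable_lty => //.
apply: (@bounded_integrable _ _ _ mu (fun x => `|\1_A x| `^ 2)%R 1%R) => //.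
  apply: (measurableT_comp (measurable_powR _)) => //.
  exact: measurableT_comp.
move=> x; rewrite indicE; case: (x \in A).
  by rewrite normr1 powR1 normr1.
by rewrite normr0 powR0 ?normr0// pnatr_eq0.
Qed.

Lemma Lnorm2_ae0 u : measurable_fun setT u -> ae_eq mu setT u (cst 0%R) ->
  'N[mu]_2%:E[EFin \o u] = 0.
Proof.
move=> mu_ u0; rewrite unlock /Lnorm (ae_eq_integral (cst 0))//.
- by rewrite integral0 poweR0r// invr_eq0 pnatr_eq0.
- apply: (measurableT_comp (measurable_poweR _)) => //.
  by apply: measurableT_comp => //; exact/measurable_EFinP.
- apply: filterS u0 => x /(_ Logic.I) /= -> _.
  by rewrite normr0 powR0 ?pnatr_eq0.
Qed.

Lemma Lnorm2_eq0 u : measurable_fun setT u -> 'N[mu]_2%:E[EFin \o u] = 0 ->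
  ae_eq mu setT u (cst 0%R).
Proof.
move=> mu_ N0; have p0 : 0 < 2%:E :> \bar R by rewrite lte_fin.
have /Lnorm_eq0_eq0 : measurable_fun setT (EFin \o u) by exact/measurable_EFinP.
move=> /(_ _ _ p0 N0); apply: filterS => x /= E _.
by have [] := E Logic.I.
Qed.

Lemma integral_sqr_eq0 u : u \in Lfun mu 2%:E ->
  \int[mu]_x ((u x) ^+ 2)%:E = 0 -> ae_eq mu setT u (cst 0%R).
Proof.
move=> u2 I0.
have mu2 := Lfun2_measurable u2.
have : ae_eq mu setT (fun x => ((u x) ^+ 2)%:E) (cst 0).
  apply/ae_eq_integral_abs => //.
    by apply/measurable_EFinP; exact: measurable_funX.
  rewrite -[RHS]I0; apply: eq_integral => x _.
  by rewrite abse_EFin ger0_norm// sqr_ge0.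
apply: filterS => x /(_ Logic.I) /= [] /eqP; rewrite sqrf_eq0 => /eqP ux _.
exact: ux.
Qed.

End L2_functions.

Section bounded_operator.
Context {R : realType} {Omega : set (R * R)} {oOmega : open Omega}.
Notation leb := (leb_on oOmega).
Variable T : (R * R -> R) -> R * R -> R.
Hypothesis hT : bounded_linear_L2 oOmega T.
Implicit Types u v : plane R -> R.

Lemma operator0 : ae_eq leb setT (T (cst 0)) (cst 0).
Proof.
have z2 := Lfun2_cst0 leb.
have := L2_linear hT 1 z2 z2.
rewrite (_ : (fun x => 1 * cst 0 x + cst 0 x) = cst 0); last first.
  by apply/funext => x; rewrite mulr0 addr0.
apply: filterS => x /(_ Logic.I) E _.
by apply: (addrI (T (cst 0) x)); rewrite [RHS]addr0 {3}E mul1r.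
Qed.

Lemma operator_scale (a : R) u : u \in Lfun leb 2%:E ->
  ae_eq leb setT (T (fun x => a * u x)) (fun x => a * T u x).
Proof.
move=> u2; have := L2_linear hT a u2 (Lfun2_cst0 leb).
rewrite (_ : (fun x => a * u x + cst 0 x) = (fun x => a * u x)); last first.
  by apply/funext => x; rewrite addr0.
apply: filterS2 operator0 => x /(_ Logic.I) T0 /(_ Logic.I) E _.
by rewrite E T0 addr0.
Qed.

Lemma operator_midpoint u v : u \in Lfun leb 2%:E -> v \in Lfun leb 2%:E ->
  ae_eq leb setT (T (fun x => 2^-1 * u x + 2^-1 * v x))
    (fun x => 2^-1 * T u x + 2^-1 * T v x).
Proof.
move=> u2 v2; have := L2_linear hT 2^-1 u2 (Lfun2_scale 2^-1 v2).
apply: filterS2 (operator_scale 2^-1 v2) => x /(_ Logic.I) Tv /(_ Logic.I) E _.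
by rewrite E Tv.
Qed.

(** The operator acts on representatives; the norm bound applied to a null
    function shows that it is well defined on classes. *)
Lemma operator_ae_eq u v : u \in Lfun leb 2%:E -> v \in Lfun leb 2%:E ->
  ae_eq leb setT u v -> ae_eq leb setT (T u) (T v).
Proof.
move=> u2 v2 uv; have w2 := Lfun2B u2 v2.
have Tw2 := L2_stable hT w2.
have w0 : ae_eq leb setT (fun x => u x - v x) (cst 0).
  by apply: filterS uv => x /(_ Logic.I) /= -> _; rewrite subrr.
have Tw0 : ae_eq leb setT (T (fun x => u x - v x)) (cst 0).
  have [C HC] := L2_bounded hT; have := HC _ w2.
  rewrite (Lnorm2_ae0 (Lfun2_measurable w2) w0) mule0 => N0.
  apply: Lnorm2_eq0; first exact: Lfun2_measurable Tw2.
  by apply/eqP; rewrite eq_le N0 Lnorm_ge0.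
have := L2_linear hT 1 w2 v2.
rewrite (_ : (fun x => 1 * (u x - v x) + v x) = u); last first.
  by apply/funext => x; rewrite mul1r subrK.
by apply: filterS2 Tw0 => x /(_ Logic.I) T0 /(_ Logic.I) E _; rewrite E T0 mulr0 add0r.
Qed.

End bounded_operator.

(** * The energy and its minimisers *)

Lemma fine_le_midpoint (R : realType) (x y z : \bar R) :
  x \is a fin_num -> y \is a fin_num -> z \is a fin_num ->
  (x <= 2^-1%:E * y + 2^-1%:E * z)%E -> fine x <= 2^-1 * fine y + 2^-1 * fine z.
Proof. by move: x y z => [x||] [y||] [z||]. Qed.

(** The energies of [u], [v] and their average [w] are compared; [t] is the
    surplus of the parallelogram identity. *)
Lemma convex_energy_gap (R : realType) (a b fu fv fw t gu gv gw hu hv hw : R) :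
  0 < a -> 0 < b -> 0 <= t ->
  fw + t = 2^-1 * fu + 2^-1 * fv ->
  gw <= 2^-1 * gu + 2^-1 * gv -> hw <= 2^-1 * hu + 2^-1 * hv ->
  2^-1 * fu + a * gu + b * hu <= 2^-1 * fw + a * gw + b * hw ->
  2^-1 * fv + a * gv + b * hv <= 2^-1 * fw + a * gw + b * hw ->
  t = 0 /\ gw = 2^-1 * gu + 2^-1 * gv.
Proof.
move=> a0 b0 t0 fE gle hle uw vw.
have := ler_wpM2l (ltW a0) gle; have := ler_wpM2l (ltW b0) hle.
rewrite !mulrDr => bh ag; have te0 : t = 0 by lra.
split => //; apply: (mulfI (lt0r_neq0 a0)); rewrite mulrDr; lra.
Qed.

Section energy.
Context {R : realType} {Omega : set (R * R)} {oOmega : open Omega}.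
Notation leb := (leb_on oOmega).

Lemma leb_on_lty : bounded_set Omega -> (leb setT < +oo)%E.
Proof.
move=> [M [_ HM]]; pose N := `|M| + 1.
have N0 : 0 < N by rewrite ltr_wpDl.
have HN z : Omega z -> `|z| <= N.
  by apply: HM; rewrite /N ltr_pwDr// ler_norm.
have ON : Omega `<=` box (- (N + 1)) N (- (N + 1)) N.
  move=> [x y] /HN; rewrite prod_normE ge_max => /andP[/=].
  rewrite !ler_norml => /andP[? ?] /andP[? ?].
  by split; rewrite /= in_itv/=; apply/andP; split; lra.
rewrite /leb_on /mrestr setTI.
apply: (@le_lt_trans _ _ (leb2 (box (- (N + 1)) N (- (N + 1)) N))).
  apply: le_measure => //; rewrite inE.
    exact: open_measurable_plane.
  exact: measurable_box.
rewrite [ltLHS]product_measure1E; [|exact: measurable_itv..].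
by rewrite [X in (X * _)%E]lebesgue_measure_itv [X in (_ * X)%E]lebesgue_measure_itv/=;
  case: ifP => _; rewrite ?mule0 ?mul0e ?ltry.
Qed.

Variables (T : (R * R -> R) -> R * R -> R) (u0 : plane R -> R).
Hypothesis hT : bounded_linear_L2 oOmega T.
Hypothesis hu0 : u0 \in Lfun leb 2%:E.
Implicit Types u v : plane R -> R.

Definition misfit (u : plane R -> R) : R := fine (\int[leb]_x ((u0 x - T u x) ^+ 2)%:E).

Lemma misfitE u : u \in Lfun leb 2%:E ->
  (\int[leb]_x ((u0 x - T u x) ^+ 2)%:E = (misfit u)%:E)%E.
Proof.
move=> u2; rewrite fineK// integrable_fin_num//.
exact: Lfun2_integrable_sqr (Lfun2B hu0 (L2_stable hT u2)).
Qed.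

Lemma misfit_parallelogram u v : u \in Lfun leb 2%:E -> v \in Lfun leb 2%:E ->
  misfit (fun x => 2^-1 * u x + 2^-1 * v x) +
    fine (\int[leb]_x ((2^-1 * (T u x - T v x)) ^+ 2)%:E) =
  2^-1 * misfit u + 2^-1 * misfit v.
Proof.
move=> u2 v2.
have w2 : (fun x => 2^-1 * u x + 2^-1 * v x) \in Lfun leb 2%:E.
  exact: Lfun2_lincomb u2 (Lfun2_scale 2^-1 v2).
have d2 := Lfun2_scale 2^-1 (Lfun2B (L2_stable hT u2) (L2_stable hT v2)).
have fu := Lfun2B hu0 (L2_stable hT u2).
have fv := Lfun2B hu0 (L2_stable hT v2).
have fw := Lfun2B hu0 (L2_stable hT w2).
have msqr (x : plane R -> R) : x \in Lfun leb 2%:E ->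
    measurable_fun setT (fun z => x z ^+ 2).
  by move=> /Lfun2_measurable mx; exact: measurable_funX.
apply/EFin_inj; rewrite !EFinD !EFinM -(misfitE u2) -(misfitE v2) -(misfitE w2).
rewrite fineK; last by rewrite integrable_fin_num//; exact: Lfun2_integrable_sqr.
rewrite -ge0_integralD//; try (by move=> x _; rewrite lee_fin sqr_ge0);
  try (apply/measurable_EFinP; exact: msqr).
rewrite -ge0_integral_midpoint//; try (by move=> x; exact: sqr_ge0); try exact: msqr.
apply: ae_eq_integral => //.
- apply/measurable_EFinP; apply: measurable_funD; exact: msqr.
- apply/measurable_EFinP; apply: measurable_funD; apply: measurable_funM => //; exact: msqr.
- apply: filterS (operator_midpoint hT u2 v2) => x /(_ Logic.I) /= -> _.
  by rewrite -EFinD; congr EFin; field.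
Qed.

Variables (f : 'rV[R]_2 -> R) (K1 : R).
Hypothesis f_ge0 : forall x, 0 <= f x.
Hypothesis f_convex : convex_function setT f.
Hypothesis K10 : 0 <= K1.
Hypothesis f_le : forall x, f x <= K1 * (1 + l1norm x).
Hypothesis Omega_bounded : bounded_set Omega.

Let f_lip := convex_growth_lipschitz_norm f_convex K10 f_le.

Definition grad_energy (w : BH oOmega) : R := fine (\int[leb]_x (f (BH_grad w x))%:E).

Lemma measurable_grad_density (w : BH oOmega) :
  measurable_fun setT ((fun x => f (BH_grad w x)) : plane R -> R).
Proof. exact: (measurable_lipschitz_comp f_lip (measurable_BH_grad w)). Qed.

Lemma grad_density_integrable (w : BH oOmega) :
  leb.-integrable setT (fun x => (f (BH_grad w x))%:E).
Proof.
exact: (integrable_lipschitz_comp measurableT (leb_on_lty Omega_bounded) f_ge0 f_lip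
  (measurable_BH_grad w) (BH_grad_integrable w)).
Qed.

Lemma grad_energyE (w : BH oOmega) :
  (\int[leb]_x (f (BH_grad w x))%:E = (grad_energy w)%:E)%E.
Proof. by rewrite fineK// integrable_fin_num//; exact: grad_density_integrable. Qed.

Lemma grad_energy_midpoint (u v w : BH oOmega) :
  BH_grad w = (fun x => 2^-1 *: BH_grad u x + 2^-1 *: BH_grad v x) ->
  grad_energy w <= 2^-1 * grad_energy u + 2^-1 * grad_energy v.
Proof.
move=> wE; rewrite -lee_fin EFinD !EFinM -(grad_energyE w) -(grad_energyE u) -(grad_energyE v).
apply: ge0_integral_le_midpoint => //; try exact: measurable_grad_density.
by apply: aeW => x; rewrite wE; exact: convex_midpoint.
Qed.

(** The gap in the midpoint inequality for [f] is nonnegative with zero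
    integral, hence zero almost everywhere. *)
Lemma grad_energy_strict (u v w : BH oOmega) : strictly_convex f ->
  BH_grad w = (fun x => 2^-1 *: BH_grad u x + 2^-1 *: BH_grad v x) ->
  grad_energy w = 2^-1 * grad_energy u + 2^-1 * grad_energy v ->
  {ae leb, forall x : plane R, BH_grad u x = BH_grad v x}.
Proof.
move=> fs wE Eeq.
pose gap (x : plane R) := 2^-1 * f (BH_grad u x) + 2^-1 * f (BH_grad v x) - f (BH_grad w x).
have gap0 x : 0 <= gap x.
  by rewrite subr_ge0 wE; exact: convex_midpoint.
have iu := grad_density_integrable u; have iv := grad_density_integrable v.
have iw := grad_density_integrable w.
have iuv := integrable_midpoint iu iv.
have Igap : (\int[leb]_x (gap x)%:E = 0)%E.
  under eq_integral do rewrite EFinB.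
  rewrite integralB// integral_midpoint// !grad_energyE.
  rewrite [LHS](_ : _ = (2^-1 * grad_energy u + 2^-1 * grad_energy v - grad_energy w)%:E)//.
  by rewrite Eeq subrr.
have : ae_eq leb setT (EFin \o gap) (cst 0%E).
  apply/ae_eq_integral_abs => //.
    apply/measurable_EFinP; apply: measurable_funB; last exact: measurable_grad_density.
    by apply: measurable_funD; apply: measurable_funM => //; exact: measurable_grad_density.
  rewrite -[RHS]Igap; apply: eq_integral => x _.
  by rewrite abse_EFin ger0_norm.
apply: filterS => x /(_ Logic.I) /= [] gx.
apply/eqP; apply/negPn/negP => /fs /(_ 2^-1).
have -> : 0 < (2^-1 : R) < 1 by apply/andP; split; lra.
have -> : 1 - 2^-1 = 2^-1 :> R by lra.
move=> /(_ isT); move: gx; rewrite /gap wE; lra.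
Qed.

End energy.

Section minimisers.
Context {R : realType} {Omega : set (R * R)} {oOmega : open Omega}.
Notation leb := (leb_on oOmega).
Variables (T : (R * R -> R) -> R * R -> R) (u0 : plane R -> R).
Variables (f : 'rV[R]_2 -> R) (g : 'rV[R]_(2 * 2) -> R) (K1 K2 alpha beta : R).
Hypotheses (Omega_bounded : bounded_set Omega).
Hypothesis hT : bounded_linear_L2 oOmega T.
Hypothesis hu0 : u0 \in Lfun leb 2%:E.
Hypotheses (alpha0 : 0 < alpha) (beta0 : 0 < beta).
Hypotheses (f_ge0 : forall x, 0 <= f x) (g_ge0 : forall x, 0 <= g x).
Hypotheses (f_convex : convex_function setT f) (g_convex : convex_function setT g).
Hypotheses (K10 : 0 <= K1) (K20 : 0 <= K2).
Hypothesis f_le : forall x, f x <= K1 * (1 + l1norm x).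
Hypothesis g_le : forall x, g x <= K2 * (1 + l1norm x).
Implicit Types u v w : BH oOmega.

Notation E := (Hex T u0 alpha beta f g).

Definition hess_energy w : R := fine (convex_of_measure leb2 g (BH_hess w) Omega).

Let leb2_lty : (leb2 Omega < +oo)%E.
Proof. by have := leb_on_lty (oOmega := oOmega) Omega_bounded; rewrite /leb_on /mrestr setTI. Qed.

Let mOmega : measurable (Omega : set (plane R)) := open_measurable_plane oOmega.

Lemma hess_energy_fin_num w :
  convex_of_measure leb2 g (BH_hess w) Omega \is a fin_num.
Proof.
rewrite ge0_fin_numE.
  exact: (convex_of_measure_lty g_ge0 g_convex K20 g_le (BH_hess w) mOmega leb2_lty).
exact: (convex_of_measure_ge0 leb2 g_ge0 g_convex K20 g_le (BH_hess w) Omega).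
Qed.

Lemma hess_energyE w :
  (convex_of_measure leb2 g (BH_hess w) Omega = (hess_energy w)%:E)%E.
Proof. exact: (esym (fineK (hess_energy_fin_num w))). Qed.

Lemma HexE w : (w : plane R -> R) \in Lfun leb 2%:E ->
  (E w = (2^-1 * misfit T u0 (oOmega := oOmega) w + alpha * grad_energy f w +
    beta * hess_energy w)%:E)%E.
Proof.
move=> w2; rewrite /Hex /fidelity w2 (misfitE hT hu0 w2).
by rewrite (grad_energyE f_ge0 f_convex K10 f_le Omega_bounded) (hess_energyE w).
Qed.

(** The zero function has finite energy, while the data term is infinite outside
    of the space of square integrable functions. *)
Lemma minimiser_L2 u : minimiser E u -> (u : plane R -> R) \in Lfun leb 2%:E.
Proof.
move=> u_min; apply/negPn/negP => u2.
have [z z0] := @BH_zero _ _ oOmega.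
have z2 : (z : plane R -> R) \in Lfun leb 2%:E by rewrite z0; exact: Lfun2_cst0.
have := u_min z; rewrite (HexE z2) /Hex /fidelity (negbTE u2).
rewrite (grad_energyE f_ge0 f_convex K10 f_le Omega_bounded) (hess_energyE u).
by rewrite -!EFinM /= leye_eq.
Qed.

Lemma hess_energy_midpoint u v w :
  (forall k, charge_midpoint (BH_hess w k) (BH_hess u k) (BH_hess v k)) ->
  hess_energy w <= 2^-1 * hess_energy u + 2^-1 * hess_energy v.
Proof.
move=> wE; apply: (fine_le_midpoint (hess_energy_fin_num w) (hess_energy_fin_num u)
  (hess_energy_fin_num v)).
exact: (@convex_of_measure_midpoint _ _ R 2 2 leb2 g K2 g_ge0 g_convex K20 g_le
  (BH_hess w) (BH_hess u) (BH_hess v) Omega mOmega wE).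
Qed.

Lemma minimisers_agree u v : minimiser E u -> minimiser E v ->
  ae_eq leb setT (T u) (T v) /\
  (strictly_convex f -> {ae leb, forall x : plane R, BH_grad u x = BH_grad v x}).
Proof.
move=> u_min v_min.
have u2 := minimiser_L2 u_min; have v2 := minimiser_L2 v_min.
have [w [wf wg wh]] := BH_midpoint u v.
have w2 : (w : plane R -> R) \in Lfun leb 2%:E.
  by rewrite wf; exact: Lfun2_lincomb u2 (Lfun2_scale 2^-1 v2).
have uw := u_min w; have vw := v_min w.
rewrite (HexE u2) (HexE w2) lee_fin in uw.
rewrite (HexE v2) (HexE w2) lee_fin in vw.
have mis := misfit_parallelogram hT hu0 u2 v2.
have gra := grad_energy_midpoint f_ge0 f_convex K10 f_le Omega_bounded wg.
have hes := hess_energy_midpoint wh.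
rewrite -wf in mis.
have t0 : 0 <= fine (\int[leb]_x ((2^-1 * (T u x - T v x)) ^+ 2)%:E).
  by apply: fine_ge0; apply: integral_ge0 => x _; rewrite lee_fin sqr_ge0.
have [t_eq0 gE] := convex_energy_gap alpha0 beta0 t0 mis gra hes uw vw.
split.
  have d2 := Lfun2_scale 2^-1 (Lfun2B (L2_stable hT u2) (L2_stable hT v2)).
  have : (\int[leb]_x ((2^-1 * (T u x - T v x)) ^+ 2)%:E = 0)%E.
    rewrite -[LHS]fineK ?t_eq0// integrable_fin_num//.
    exact: Lfun2_integrable_sqr d2.
  move/(integral_sqr_eq0 d2); apply: filterS => x /(_ Logic.I) /= /eqP.
  by rewrite mulf_eq0 invr_eq0 pnatr_eq0/= subr_eq0 => /eqP Tx _.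
move=> fs.
exact: (grad_energy_strict f_ge0 f_convex K10 f_le Omega_bounded fs wg gE).
Qed.

Lemma ae_eq_grad_cst u v : connected Omega ->
  {ae leb, forall x : plane R, BH_grad u x = BH_grad v x} ->
  exists k : R, {ae leb, forall x : plane R, u x - v x = k}.
Proof.
move=> cO guv.
have iu := BH_fun_integrable u; have iv := BH_fun_integrable v.
apply: (weak_grad0_cst (leb_on_lty Omega_bounded)) => //.
  by apply: eq_integrable (integrableB measurableT iu iv).
move=> i phi tphi; have tpphi := test_function_partial i tphi.
under eq_integral do rewrite mulrBl EFinB.
rewrite integralB//; [|exact: integrableM_test tpphi _..].
rewrite !BH_weak_grad//.
have gu := integrableM_test tphi (BH_grad_integrable u i).
have gv := integrableM_test tphi (BH_grad_integrable v i).
have -> : (\int[leb]_x (BH_grad u x 0%R i * phi x)%:E =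
    \int[leb]_x (BH_grad v x 0%R i * phi x)%:E)%E.
  apply: ae_eq_integral => //; [exact: measurable_int gu|exact: measurable_int gv|].
  by apply: filterS guv => x -> _.
by rewrite subee// fin_numN integrable_fin_num.
Qed.

End minimisers.

Theorem proposition3p9 (R : realType) (Omega : set (R * R))
  (oOmega : open Omega) (bOmega : bounded_set Omega)
  (cOmega : connected Omega) (lOmega : lipschitz_boundary Omega)
  (T : (R * R -> R) -> R * R -> R) (hT : bounded_linear_L2 oOmega T)
  (u0 : plane R -> R) (hu0 : u0 \in Lfun (leb_on oOmega) 2%:E)
  (alpha beta : R) (halpha : 0 < alpha) (hbeta : 0 < beta)
  (f : 'rV[R]_2 -> R) (g : 'rV[R]_4 -> R)
  (f_ge0 : forall x, 0 <= f x) (g_ge0 : forall x, 0 <= g x)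
  (f_convex : convex_function setT f) (g_convex : convex_function setT g)
  (f_min : forall x, f 0 <= f x) (g_min : forall x, g 0 <= g x)
  (K1 K2 K3 K4 : R) (hK1 : 0 < K1) (hK2 : 0 < K2) (hK3 : 0 < K3) (hK4 : 0 < K4)
  (f_growth : forall x : 'rV[R]_2, K3 * enorm (x 0) <= f x <= K1 * (1 + enorm (x 0)))
  (g_growth : forall x : 'rV[R]_4, K4 * enorm (x 0) <= g x <= K2 * (1 + enorm (x 0)))
  (T_indic : ~ ae_eq (leb_on oOmega) setT (T \1_Omega) (cst 0))
  (T_inj_or_f_strict : injective_L2 oOmega T \/ strictly_convex f)
  (u v : BH oOmega)
  (u_min : minimiser (Hex T u0 alpha beta f g) u)
  (v_min : minimiser (Hex T u0 alpha beta f g) v) :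
  ae_eq (leb_on oOmega) setT u v.
Proof.
have f_le x : f x <= K1 * (1 + l1norm x).
  have /andP[_ /le_trans] := f_growth x; apply.
  by rewrite ler_pM2l// lerD2l enorm_le_l1norm.
have g_le (x : 'rV[R]_(2 * 2)) : g x <= K2 * (1 + l1norm x).
  have /andP[_ /le_trans] := g_growth x; apply.
  by rewrite ler_pM2l// lerD2l; exact: enorm_le_l1norm.
have u2 := minimiser_L2 bOmega hT hu0 f_ge0 g_ge0 f_convex g_convex
  (ltW hK1) (ltW hK2) f_le g_le u_min.
have v2 := minimiser_L2 bOmega hT hu0 f_ge0 g_ge0 f_convex g_convex
  (ltW hK1) (ltW hK2) f_le g_le v_min.
have [Tuv guv] := minimisers_agree bOmega hT hu0 halpha hbeta f_ge0 g_ge0 f_convex g_convex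
  (ltW hK1) (ltW hK2) f_le g_le u_min v_min.
case: T_inj_or_f_strict => [T_inj|/guv {}guv]; first exact: T_inj.
have [k uvk] := ae_eq_grad_cst bOmega cOmega guv.
have i2 : (\1_Omega : plane R -> R) \in Lfun (leb_on oOmega) 2%:E.
  apply: Lfun2_indic (leb_on_lty bOmega) _; exact: open_measurable_plane.
have uE : ae_eq (leb_on oOmega) setT u (fun x => k * \1_Omega x + v x).
  move: uvk (@ae_leb_on _ _ oOmega); apply: filterS2 => x uvx Ox _.
  by rewrite indicE mem_set// mulr1 -uvx subrK.
have Tu : ae_eq (leb_on oOmega) setT (T u) (fun x => k * T \1_Omega x + T v x).
  have := operator_ae_eq hT u2 (Lfun2_lincomb k i2 v2) uE.
  by move/ae_eq_trans; apply; exact: L2_linear.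
have [k0|k0] := eqVneq k 0.
  apply: filterS uE => x /(_ Logic.I) -> _.
  by rewrite k0 mul0r add0r.
exfalso; apply: T_indic.
apply: filterS2 Tu Tuv => x /(_ Logic.I) E1 /(_ Logic.I) E2 _.
have : k * T \1_Omega x = 0.
  by apply: (addIr (T v x)); rewrite add0r -E1 E2.
by move/eqP; rewrite mulf_eq0 (negbTE k0) => /eqP.
Qed.
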